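(* Let $\alpha_\bullet$ be an $m$-shifted $2$-form on a Lie $n$-groupoid $X_\bullet$, with IM-form $\lambda^{\alpha_\bullet}$. Then: (1) $\lambda^{\alpha_\bullet}$ vanishes on degenerate vectors: if $m\ge1$, then for any $x\in X_0$ and $p+q=m$ (with $p\ge 1$), $$\lambda^{\alpha_\bullet}_x(Ts_iu,w)=0\qquad\forall\,u\in T_xX_{p-1},\ w\in T_xX_q,\ 0\le i\le p-1.$$ (For $m=0$ this is an empty condition.) (2) If $m\ge1$, then for $v\in\mathcal T_{p+1}(X_\bullet)$, $w\in\mathcal T_q(X_\bullet)$ with $0\le p\le m-1$ and $p+q=m$, $$\lambda^{\alpha_\bullet}(\partial v,w)+(-1)^{p+1}\lambda^{\alpha_\bullet}(v,\partial w)=\lambda^{D\alpha_\bullet}(v,w);$$ if $m=0$, then for $v\in\mathcal T_1(X_\bullet)$, $w\in\mathcal T_0(X_\bullet)=TX_0$, $\lambda^{\alpha_\bullet}(\partial v,w)=\lambda^{D\alpha_\bullet}(v,w)$. In particular, if $\alpha_\bullet$ is closed the right-hand sides vanish. (3) The map $\lambda^{\alpha_\bullet,\#}_x:\mathcal T_\bullet|_xX\to\mathcal T^*_\bullet|_xX[-m]$ is invariant under gauge transformations up to chain homotopy: for any $(m-1)$-shifted $2$-form $\phi_\bullet$ there is a chain homotopy $$\lambda_x^{\alpha_\bullet+D\phi_\bullet,\#}\simeq\lambda_x^{\alpha_\bullet,\#}:\mathcal T_\bullet|_xX\to\mathcal T_\bullet^*|_xX[-m].$$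
   Context: A Lie $n$-groupoid is a simplicial (Banach) manifold $X_\bullet$ (faces $d_i$, degeneracies $s_i$) whose horn projections $p_{l,j}(x)=(d_ix)_{i\ne j}$, from $X_l$ to $\{(x_i)_{i\ne j}\in X_{l-1}^l:d_ax_b=d_{b-1}x_a,\ a<b\}$, are surjective submersions for all $l\ge1$, $0\le j\le l$, and diffeomorphisms for $l>n$. $X_0$ is embedded in each $X_l$ by iterated degeneracies. Tangent complex (of vector bundles over $X_0$): $\mathcal T_0X=TX_0$, $\mathcal T_lX=\bigcap_{i=0}^{l-1}\ker Td_i|_{X_0}\subset TX_l|_{X_0}$ for $l>0$, zero for $l<0$, $\partial=(-1)^lTd_l:\mathcal T_l\to\mathcal T_{l-1}$. Cotangent complex: $\mathcal T^*_iX=(\mathcal T_{-i}X)^*$ with $\partial^*_i=(-1)^{-i+1}\partial_{-i+1}^t$. On forms, $\delta=\sum_i(-1)^id_i^*$ and $D=\delta+(-1)^pd$ on $\Omega^\bullet(X_p)$. An $m$-shifted $2$-form is $\alpha_\bullet=\sum_{i=0}^m\alpha_i$, $\alpha_i\in\Omega^{2+m-i}(X_i)$ normalized (all $s_j^*\alpha_i=0$); closed means $D\alpha_\bullet=0$. IM-form: for $x\in X_0$, $0\le l\le m$, $v\in T_xX_l$, $w\in T_xX_{m-l}$, $$\lambda^{\alpha_\bullet}_x(v,w)=\sum_{\sigma}(-1)^\sigma\alpha_m\big(T(s_{\sigma(m-1)}\cdots s_{\sigma(l)})v,T(s_{\sigma(l-1)}\cdots s_{\sigma(0)})w\big),$$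 sum over $(l,m-l)$-shuffles $\sigma$, i.e. permutations of $\{0,\dots,m-1\}$ with $\sigma(0)<\dots<\sigma(l-1)$ and $\sigma(l)<\dots<\sigma(m-1)$; $\lambda=0$ for $l<0$ or $l>m$; terms involving $\mathcal T_{-1}=0$ vanish. $\lambda^{D\alpha_\bullet}$ is given by the same formula with $m$ replaced by $m+1$ and $\alpha_m$ replaced by the level-$(m+1)$ component $\delta\alpha_m\in\Omega^2(X_{m+1})$ of $D\alpha_\bullet$. $\lambda^{\alpha_\bullet,\#}(v)=\lambda^{\alpha_\bullet}(v,\cdot)$. In (3), chain homotopic means that the difference of the two graded maps is the graded commutator of a degree-one map with the differentials. *)

(* Defs.v *)
From HB Require Import structures.
From mathcomp Require Import all_boot all_order all_algebra perm.
From mathcomp Require Import boolp classical_sets functions reals topology.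
From mathcomp Require Import normedtype derive.

Set Implicit Arguments.
Unset Strict Implicit.
Unset Printing Implicit Defensive.

Import Order.TTheory GRing.Theory Num.Theory.
Import numFieldNormedType.Exports.

Local Open Scope classical_set_scope.
Local Open Scope ring_scope.

(** * Smooth maps between open subsets of normed spaces *)

(* On an open set U, f is C^(n+1) when it is Frechet differentiable at every
   point of U and its tangent map (x, v) |-> 'd f x v is C^n on U x E.  For a
   single n this is slightly weaker than norm-continuity of the derivatives,
   but joint C^1 regularity of the tangent map makes x |-> 'd f x continuous
   for the operator norm, so "for all n" is the usual C^oo. *)
Fixpoint Ck (R : realType) (n : nat) (E F : normedModType R)
    (U : set E) (f : E -> F) : Prop :=
  match n with
  | 0 => forall x, U x -> {for x, continuous f}
  | n'.+1 => (forall x, U x -> differentiable f x) /\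
             @Ck R n' (E * E)%type F (U `*` setT)
                 (fun z => 'd f (z.1) (z.2))
  end.

Definition smooth_on (R : realType) (E F : normedModType R)
    (U : set E) (f : E -> F) : Prop := forall n, Ck n U f.

(** * Banach manifolds *)

(* The atlas need not be maximal and the model space may depend on the chart.
   [phi c] and [phiV c] are total functions that are meaningful only on
   [dom c] and on its image.  Each point x carries a preferred chart
   [chart_at x] around it, so that T_xM can be taken to be the model space of
   that chart. *)
Record manifold (R : realType) := Manifold {
  carrier :> topologicalType;
  chart : Type;
  model : chart -> completeNormedModType R;
  dom : chart -> set carrier;
  phi : forall c, carrier -> model c;
  phiV : forall c, model c -> carrier;
  chart_at : carrier -> chart;
  manifold_hausdorff : hausdorff_space carrier;
  dom_open : forall c, open (dom c);
  img_open : forall c, open (@phi c @` dom c);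
  phi_continuous : forall c x, dom c x -> {for x, continuous (@phi c)};
  phiV_continuous : forall c y, (@phi c @` dom c) y ->
    {for y, continuous (@phiV c)};
  phiK : forall c x, dom c x -> phiV (@phi c x) = x;
  transition_smooth : forall c c',
    smooth_on (@phi c @` (dom c `&` dom c')) (@phi c' \o @phiV c);
  chart_at_dom : forall x, dom (chart_at x) x }.

Arguments chart {R} m.
Arguments model {R} m _.
Arguments phi {R} m c _.
Arguments phiV {R} m c _.
Arguments dom {R} m c _.
Arguments chart_at {R} m _.

Section Manifolds.
Context {R : realType}.
Implicit Types M N : manifold R.

Definition tangent M (x : M) : completeNormedModType R :=
  model M (chart_at M x).

Definition smooth_map M N (f : M -> N) : Prop :=
  continuous f /\
  forall c c', smooth_on (phi M c @` (dom M c `&` f @^-1` dom N c'))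
                         (phi N c' \o f \o phiV M c).

(* The tangent map T_xM -> T_yN of f at x.  It is meaningful only for y = f x;
   passing y separately avoids transports when y = f x is provable but does
   not hold by computation. *)
Definition tmap M N (f : M -> N) (x : M) (y : N) (v : tangent x) : tangent y :=
  'd (phi N (chart_at N y) \o f \o phiV M (chart_at M x))
     (phi M (chart_at M x) x) v.

Definition split_kernel (E F : normedModType R) (T : E -> F) : Prop :=
  exists P : {linear E -> E},
    [/\ continuous P, forall v, T (P v) = 0 & forall v, T v = 0 -> P v = v].

Definition submersion M N (f : M -> N) : Prop :=
  smooth_map f /\
  forall x, (forall w, exists v, @tmap M N f x (f x) v = w) /\
            split_kernel (@tmap M N f x (f x)).

Definition diffeo M N (f : M -> N) : Prop :=
  smooth_map f /\
  exists g : N -> M, [/\ smooth_map g, cancel f g & cancel g f].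

(** * Differential forms *)

(* A k-form without any regularity or multilinearity condition; Omega^k(M) is
   cut out by [is_form] below. *)
Definition rform M (k : nat) := forall x : M, ('I_k -> tangent x) -> R.

Definition multilinear (k : nat) (E : lmodType R) (f : ('I_k -> E) -> R) :=
  forall (u : 'I_k -> E) (i : 'I_k) (a : R) (v w : E),
    f (@dfwith 'I_k (fun=> E) u i (a *: v + w)) =
    a * f (@dfwith 'I_k (fun=> E) u i v) + f (@dfwith 'I_k (fun=> E) u i w).

Definition alternating (k : nat) (E : lmodType R) (f : ('I_k -> E) -> R) :=
  forall (u : 'I_k -> E) (i j : 'I_k), i != j -> u i = u j -> f u = 0.

(* E x E^k as a normed space *)
Fixpoint jet (E : normedModType R) (k : nat) : normedModType R :=
  match k with 0 => E | k'.+1 => (jet E k' * E)%type end.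

Fixpoint jet_base (E : normedModType R) (k : nat) : jet E k -> E :=
  match k return jet E k -> E with
  | 0 => fun z => z
  | k'.+1 => fun z => jet_base z.1
  end.

Fixpoint jet_vec (E : normedModType R) (k : nat) :
    jet E k -> 'I_k -> E :=
  match k return jet E k -> 'I_k -> E with
  | 0 => fun _ _ => 0
  | k'.+1 => fun z i => if unlift ord_max i is Some i' then jet_vec z.1 i'
                        else z.2
  end.

(* The expression of a form in the chart c: the vectors h_a, read in c, are
   converted to the preferred chart of the base point. *)
Definition local_rep M k (w : rform M k) (c : chart M)
    (y : model M c) (h : 'I_k -> model M c) : R :=
  let x := phiV M c y in
  w x (fun a => 'd (phi M (chart_at M x) \o phiV M c) y (h a)).

(* Joint smoothness of the local representatives in the base point and the k
   vectors; it entails that each w x is a bounded multilinear form. *)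
Definition is_form M k (w : rform M k) : Prop :=
  (forall x, multilinear (w x) /\ alternating (w x)) /\
  forall c, smooth_on [set z : jet (model M c) k |
                         (phi M c @` dom M c) (jet_base z)]
              (fun z => local_rep w (jet_base z) (jet_vec z) : R^o).

Definition pullback M N (f : M -> N) k (w : rform N k) : rform M k :=
  fun x u => w (f x) (fun a => tmap f (f x) (u a)).

(* (dw)(h_0, .., h_k) = \sum_a (-1)^a h_a(w(h_0, .., ^h_a, .., h_k)) for vector
   fields h_a that are constant in the preferred chart of the base point. *)
Definition dform M k (w : rform M k) : rform M k.+1 :=
  fun x u => \sum_(a < k.+1) (-1) ^+ a *
    'd (fun y : model M (chart_at M x) =>
          local_rep w y (fun b => u (lift a b)) : R^o)
       (phi M (chart_at M x) x) (u a).

End Manifolds.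

(** * Lie n-groupoids *)

(* Faces and degeneracies are indexed by nat; only d_i for i <= n.+1 and s_i
   for i <= n are constrained (and used). *)
Record smanifold (R : realType) := SManifold {
  level :> nat -> manifold R;
  face : forall n, nat -> level n.+1 -> level n;
  dgn : forall n, nat -> level n -> level n.+1;
  face_smooth : forall n i, (i <= n.+1)%N -> smooth_map (@face n i);
  dgn_smooth : forall n i, (i <= n)%N -> smooth_map (@dgn n i);
  face_face : forall n i j (y : level n.+2), (i < j <= n.+2)%N ->
    face i (face j y) = face j.-1 (face i y);
  dgn_dgn : forall n i j (y : level n), (i <= j <= n)%N ->
    dgn i (dgn j y) = dgn j.+1 (dgn i y);
  face_dgn_lt : forall n i j (y : level n.+1), (i < j <= n.+1)%N ->
    face i (dgn j y) = dgn j.-1 (face i y);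
  face_dgn_id : forall n j (y : level n), (j <= n)%N ->
    face j (dgn j y) = y /\ face j.+1 (dgn j y) = y;
  face_dgn_gt : forall n i j (y : level n.+1), (j.+1 < i <= n.+2)%N ->
    face i (dgn j y) = dgn j (face i.-1 y) }.

Arguments face {R} s {n} i _.
Arguments dgn {R} s {n} i _.

Section LieGroupoids.
Context {R : realType} (X : smanifold R).

(* Families (x_i), 0 <= i <= k+1, i != j, of points of X_k with
   d_a x_b = d_(b-1) x_a; for k = 0 there is no condition. *)
Definition horn_compat (k j : nat) : (nat -> X k) -> Prop :=
  match k return (nat -> X k) -> Prop with
  | 0 => fun _ => True
  | k'.+1 => fun x => forall a b, (a < b <= k'.+2)%N -> a != j -> b != j ->
      face X a (x b) = face X b.-1 (x a)
  end.

(* H, with the maps pr_i (i <= k+1, i != j), is the space of (k+1, j)-horns: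
   its points are the compatible families, and its manifold structure is that
   of the limit, i.e. the one inherited from the product X_k^(k+1). *)
Definition is_horn (k j : nat) (H : manifold R) (pr : nat -> H -> X k) :=
  [/\ forall i, (i <= k.+1)%N -> i != j -> smooth_map (pr i),
      forall h, horn_compat j (fun i => pr i h),
      forall x, horn_compat j x ->
        exists! h, forall i, (i <= k.+1)%N -> i != j -> pr i h = x i
    & forall (Y : manifold R) (f : Y -> H),
        (forall i, (i <= k.+1)%N -> i != j -> smooth_map (pr i \o f)) ->
        smooth_map f].

Definition lie_groupoid (n : nat) : Prop :=
  forall k j, (j <= k.+1)%N ->
  exists (H : manifold R) (pr : nat -> H -> X k) (p : X k.+1 -> H),
    [/\ is_horn j pr,
        forall y i, (i <= k.+1)%N -> i != j -> pr i (p y) = face X i y,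
        (forall h, exists y, p y = h) /\ submersion p
      & (n < k.+1)%N -> diffeo p].

(** * Shifted 2-forms *)

(* Families of forms in Omega^k(X_i), over all i and k *)
Definition bform := forall i k, rform (X i) k.

Definition simpl_delta p k (w : rform (X p) k) : rform (X p.+1) k :=
  fun y u => \sum_(i < p.+2) (-1) ^+ i * pullback (face X i) w u.

Definition bform_add (a b : bform) : bform :=
  fun i k y u => a i k y u + b i k y u.

Definition totalD (a : bform) : bform := fun i k y u =>
  match i return forall y : X i, ('I_k -> tangent y) -> R with
  | 0 => fun _ _ => 0
  | i'.+1 => simpl_delta (a i' k)
  end y u +
  (-1) ^+ i *
  match k return ('I_k -> tangent y) -> R with
  | 0 => fun _ => 0
  | k'.+1 => @dform _ _ k' (a i k') y
  end u.

Definition bform_zero (a : bform) : Prop := forall i k y u, a i k y u = 0.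

(* An m-shifted 2-form is a_0 + ... + a_m with a_i in Omega^(2+m-i)(X_i), so
   the component (i, k) vanishes unless i <= m and i + k = m + 2.  The shift
   is an integer so that (m-1)-shifted 2-forms make sense for m = 0, where
   they are zero. *)
Definition shifted_2form (m : int) (a : bform) : Prop :=
  [/\ forall i k, is_form (a i k),
      forall i k j (y : X i) (u : 'I_k -> tangent y), (j <= i)%N ->
        pullback (dgn X j) (a i.+1 k) u = 0
    & forall i k, ~~ ((i%:Z <= m) && (i%:Z + k%:Z == m + 2)) ->
        forall y u, a i k y u = 0].

(** * Tangent complex and IM-form *)

(* The embedding of X_0 in X_l by iterated degeneracies *)
Fixpoint dgn0 (l : nat) (x : X 0) : X l :=
  match l return X l with 0 => x | l'.+1 => dgn X 0 (dgn0 l' x) end.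

(* T_xX_l *)
Definition tgt (x : X 0) (l : nat) : normedModType R := tangent (dgn0 l x).

Definition tgt_face x l i : tgt x l.+1 -> tgt x l :=
  tmap (face X i) (dgn0 l x).

Definition tgt_dgn x l i : tgt x l -> tgt x l.+1 :=
  tmap (dgn X i) (dgn0 l.+1 x).

(* The fibre at x of the tangent complex, as a subspace of T_xX_l *)
Definition in_tc x l : set (tgt x l) :=
  match l return set (tgt x l) with
  | 0 => setT
  | l'.+1 => [set v | forall i, (i < l'.+1)%N -> tgt_face i v = 0]
  end.

Definition bd x l (v : tgt x l.+1) : tgt x l :=
  (-1) ^+ l.+1 *: tgt_face l.+1 v.

(* s_(f (k-1)) ... s_(f 0) : X_l -> X_(k+l) *)
Fixpoint dgns (f : nat -> nat) (k l : nat) (y : X l) : X (k + l)%N :=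
  match k return X (k + l)%N with
  | 0 => y
  | k'.+1 => dgn X (f k') (dgns f k' y)
  end.

Definition shuffle (p q : nat) (s : 'S_(p + q)) : bool :=
  [forall a : 'I_(p + q), forall b : 'I_(p + q), (a < b)%N && ((b < p)%N || (p <= a)%N) ==>
                       (s a < s b)%N].

Definition perm_nat n (s : 'S_n) (i : nat) : nat :=
  nth 0%N [seq (s a : nat) | a <- enum 'I_n] i.

Definition vec2 (E : Type) (v w : E) : 'I_2 -> E :=
  fun i => if i == ord0 then v else w.

(* The IM-form on T_xX_p x T_xX_q of a family whose degree-2 component at
   level m is a_m. *)
Definition imform (m : nat) (a : bform) (x : X 0) (p q : nat)
    (v : tgt x p) (w : tgt x q) : R :=
  if (p + q == m)%N then
    \sum_(s : 'S_(p + q) | shuffle s)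
      (-1) ^+ s *
      a (p + q)%N 2 (dgn0 (p + q) x)
        (vec2
          (tmap (fun y : X p => ecast n (X n) (addnC q p)
                   (dgns (fun i => perm_nat s (p + i)) q y))
                (dgn0 (p + q) x) v)
          (tmap (fun y : X q => dgns (perm_nat s) p y)
                (dgn0 (p + q) x) w))
  else 0.

(** * Graded maps into the shifted cotangent complex *)

(* The fibre at x of the tangent complex in all integer degrees; its elements
   of degree i are the v : tc x i with tc_in v.  As there is no
   definitional equality between tc x (i - 1 + 1) and tc x i, the differential
   tc_d x i j is defined for all i and j, and is zero unless i = j + 1. *)
Definition tc (x : X 0) (i : int) : normedModType R :=
  match i with Posz l => tgt x l | Negz _ => 'rV[R]_0 end.

Definition tc_in x (i : int) : set (tc x i) :=
  match i return set (tc x i) with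
  | Posz l => @in_tc x l
  | Negz _ => setT
  end.

Definition tc_d x (i j : int) : tc x i -> tc x j :=
  match i, j return tc x i -> tc x j with
  | Posz l, Posz k =>
      match l =P k.+1 with
      | ReflectT e => fun v => bd (ecast n (tgt x n) e v)
      | ReflectF _ => fun _ => 0
      end
  | _, _ => fun _ => 0
  end.

(* Functionals on the fibre of the tangent complex in degree -i; only their
   restrictions to the subspace tc_in matter. *)
Definition ct (x : X 0) (i : int) : Type := tc x (- i) -> R.

Definition ct_d x (i j : int) (f : ct x i) : ct x j :=
  fun w => (-1) ^ (- i + 1) * f (@tc_d x (- j) (- i) w).

(* The differential of the cotangent complex shifted by -m, whose degree i
   part is ct x (i - m) *)
Definition sct_d x (m i j : int) (f : ct x (i - m)) : ct x (j - m) :=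
  fun w => (-1) ^ m * @ct_d x (i - m) (j - m) f w.

Definition gmap x (m : int) := forall i j, tc x i -> ct x (j - m).

(* [f] is a map of degree r from the tangent complex to its shifted dual: each
   f i (i + r) is a bounded linear map into the space of bounded linear
   functionals, that is, a bounded bilinear form. *)
Definition graded_map x (m r : int) (f : gmap x m) : Prop :=
  forall i, let b := f i (i + r) in
  [/\ forall (c : R) v v' w, tc_in v -> tc_in v' -> tc_in w ->
        b (c *: v + v') w = c * b v w + b v' w,
      forall (c : R) v w w', tc_in v -> tc_in w -> tc_in w' ->
        b v (c *: w + w') = c * b v w + b v w'
    & exists C : R, forall v w, tc_in v -> tc_in w ->
        `|b v w| <= C * `|v| * `|w|].

(* The difference of f and g is [d, h] = d h + h d, as h has degree 1 and the
   differentials have degree -1. *)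
Definition chain_homotopic x (m : int) (f g : gmap x m) : Prop :=
  [/\ graded_map 0 f, graded_map 0 g &
  exists h : gmap x m, graded_map 1 h /\
    forall i (v : tc x i) (w : tc x (- (i - m))), tc_in v -> tc_in w ->
      f i i v w - g i i v w =
      @sct_d x m (i + 1) i (h i (i + 1) v) w +
      h (i - 1) i (@tc_d x i (i - 1) v) w].

(* lambda^#, which is zero except on degrees (i, j) with j = i *)
Definition imform_sharp (m : nat) (a : bform) (x : X 0) : gmap x m :=
  fun i j v =>
  match i, - (j - m%:Z) as k return tc x i -> tc x k -> R with
  | Posz p, Posz q => @imform m a x p q
  | _, _ => fun _ _ => 0
  end v.

End LieGroupoids.

Arguments imform_sharp {R X} m a x _ _ _ _.

(* Main.v *)
Require Import Defs.
From mathcomp Require Import all_boot all_order all_algebra fingroup perm zify ring.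
From mathcomp Require Import boolp classical_sets functions reals topology.
From mathcomp Require Import normedtype landau derive.
Set Implicit Arguments.
Unset Strict Implicit.
Unset Printing Implicit Defensive.
Import Order.TTheory GRing.Theory Num.Theory.
Import numFieldNormedType.Exports.
Local Open Scope ring_scope.

(* Each shuffle [s] splits {0, .., m-1} into the set A of degeneracies applied
   to w and the set B of those applied to v.

   (1) If v = s_i u and a is the i-th element of A, the simplicial identities
   give s_B s_i u = s_a u' and s_A w = s_a w', so every term vanishes because
   alpha_m is normalized.

   (2) In \lambda^{D alpha}(v, w) consider the face d_i applied to s_B v and
   s_A w.  If i - 1 and i are both in A, or both in B, the face commutes past
   the degeneracies and hits v or w below the top degree, where they are in
   the kernel; the same holds for i = 0.  If i - 1 and i are separated, the
   shuffles s and (i-1 i) s have opposite signs and equal values, since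
   d_i s_i = d_i s_{i-1} = id.  For the last face i = m + 1, removing the
   largest element m from A or from B leaves the two terms
   \lambda(bd v, w) and \lambda(v, bd w).

   (3) By (2), \lambda^{phi} itself is the homotopy, as the level-m component
   of D phi is delta phi_{m-1}. *)

(** * Shuffle sums over a pointed simplicial set *)

(* All degrees are gathered in one type, so that no transport along equations
   between degrees is needed.  As in [smanifold], the identities are only
   required for indices in range. *)
Record psset := PSSet {
  elt :> Type;
  deg : elt -> nat;
  dop : nat -> elt -> elt;
  sop : nat -> elt -> elt;
  zel : elt -> Prop;
  deg_sop : forall i t, deg (sop i t) = (deg t).+1;
  deg_dop : forall i t, deg (dop i t) = (deg t).-1;
  zel_sop : forall i t, zel t -> zel (sop i t);
  sop_sop : forall i j t, (i <= j <= deg t)%N ->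
    sop i (sop j t) = sop j.+1 (sop i t);
  dop_sop_lt : forall i j t, (i < j <= deg t)%N ->
    dop i (sop j t) = sop j.-1 (dop i t);
  dop_sop_id : forall j t, (j <= deg t)%N -> dop j (sop j t) = t;
  dop_sop_succ : forall j t, (j <= deg t)%N -> dop j.+1 (sop j t) = t;
  dop_sop_gt : forall i j t, (j.+1 < i <= (deg t).+1)%N ->
    dop i (sop j t) = sop j (dop i.-1 t) }.

Definition incr (f : nat -> nat) (k : nat) :=
  forall i j, (i < j < k)%N -> (f i < f j)%N.

Lemma incrS f k : incr f k.+1 -> incr f k.
Proof. by move=> h i j /andP[ij jk]; apply: h; lia. Qed.

(** The [k - j] distinct values [f j < .. < f (k-1)] all lie between [f j] and [N - 1]. This yields
    the range conditions on the indices of the degeneracies of a shuffle. *)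
Lemma incr_room f k N : incr f k -> (forall j, (j < k)%N -> (f j < N)%N) ->
  forall j, (j < k)%N -> (f j + (k - j) <= N)%N.
Proof.
elim: k N => [//|k IH] N hf hN j; rewrite ltnS => jk.
have [->|jk'] := eqVneq j k; first by have := hN k (leqnn _); lia.
have fk : forall i, (i < k)%N -> (f i < f k)%N by move=> i ik; apply: hf; lia.
have := IH (f k) (incrS hf) fk j; have := hN k (leqnn _); lia.
Qed.

(** * Composites of degeneracies and their faces *)

Section IteratedDegeneracies.
Context (T : psset).
Implicit Types (t u : T) (f g : nat -> nat).

Fixpoint sops f k t : T :=
  if k is k'.+1 then sop (f k') (sops f k' t) else t.

Lemma deg_sops f k t : deg (sops f k t) = (deg t + k)%N.
Proof. by elim: k => [|k IH] /=; rewrite ?addn0 // deg_sop IH addnS. Qed.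

Lemma eq_sops f g k t : (forall j, (j < k)%N -> f j = g j) ->
  sops f k t = sops g k t.
Proof.
by elim: k => [//|k IH] h /=; rewrite h // IH // => j jk; apply: h; lia.
Qed.

(** The degeneracy [s_(f j)] can be moved outermost with its index unchanged: for each later
    [f k > f j], s_(f k) s_(f j) = s_(f j) s_(f k - 1). *)
Lemma sops_factor f k t j : incr f k ->
  (forall i, (i < k)%N -> (f i <= deg t + i)%N) -> (j < k)%N ->
  exists u, [/\ (deg u).+1 = (deg t + k)%N, (f j <= deg u)%N
             & sops f k t = sop (f j) u].
Proof.
elim: k => [//|k IH] hf hr; rewrite ltnS => jk.
have [->|jk'] := eqVneq j k.
  by exists (sops f k t); rewrite deg_sops; split=> //; [lia|exact: hr].
have ltjk : (j < k)%N by lia.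
have [|u [du fu e]] := IH (incrS hf) _ ltjk; first by move=> i ik; apply: hr; lia.
have fjk : (f j < f k)%N by apply: hf; lia.
have hk : (f k <= deg t + k)%N by apply: hr.
exists (sop (f k).-1 u); split; rewrite ?deg_sop /=; try lia.
by rewrite e [RHS]sop_sop ?prednK //; lia.
Qed.

(** The inner s_i is moved outwards. Its current index [a] grows by one on meeting a value of [f]
    that is at most [a], and is kept otherwise; it thus ends as the i-th index (from 0) that is not
    a value of [f]. *)
Lemma sops_sop_factor f k t i : incr f k ->
  (forall j, (j < k)%N -> (f j <= (deg t).+1 + j)%N) -> (i <= deg t)%N ->
  exists a u, [/\ deg u = (deg t + k)%N, (a <= deg u)%N,
    forall j, (j < k)%N -> f j != a & sops f k (sop i t) = sop a u].
Proof.
move=> + + it; elim: k => [|k IH] hf hr.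
  by exists i, t; split=> //; lia.
have [|a [u [du au na e]]] := IH (incrS hf); first by move=> j jk; apply: hr; lia.
have hk : (f k <= (deg t).+1 + k)%N by apply: hr.
have fk : forall j, (j < k)%N -> (f j < f k)%N by move=> j jk; apply: hf; lia.
have [ka|ak] := leqP (f k) a.
  exists a.+1, (sop (f k) u); split; rewrite ?deg_sop /=; try lia.
    move=> j; rewrite ltnS leq_eqVlt => /orP[/eqP->|jk]; first by lia.
    by have := fk j jk; lia.
  by rewrite e sop_sop //; lia.
exists a, (sop (f k).-1 u); split; rewrite ?deg_sop /=; try lia.
  move=> j; rewrite ltnS leq_eqVlt => /orP[/eqP->|jk]; first by lia.
  exact: na.
by rewrite e [RHS]sop_sop ?prednK //; lia.
Qed.

(** As neither i - 1 nor i is a value of [f], d_i never cancels a degeneracy: it commutes past all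
    of them and reaches [t] as a face below the top one. *)
Lemma zel_dop_sops f k t i : incr f k ->
  (forall j, (j < k)%N -> (f j <= deg t + j)%N) ->
  (forall j, (j < deg t)%N -> zel (dop j t)) ->
  (forall j, (j < k)%N -> (f j != i) && ((f j).+1 != i)) ->
  (i < deg t + k)%N -> zel (dop i (sops f k t)).
Proof.
move=> + + zt; elim: k i => [|k IH] i hf hr hi ik /=.
  by apply: zt; lia.
have hk : (f k <= deg t + k)%N by apply: hr.
have fk : forall j, (j < k)%N -> (f j < f k)%N by move=> j jk; apply: hf; lia.
have hrk : forall j, (j < k)%N -> (f j <= deg t + j)%N by move=> j jk; apply: hr; lia.
have [ltik|leki] := ltnP i (f k).
  rewrite dop_sop_lt ?deg_sops; last lia.
  apply/zel_sop/IH => //; first exact: incrS hf; last lia.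
  by move=> j jk; apply: hi; lia.
have := hi k (leqnn _) => hk'.
rewrite dop_sop_gt ?deg_sops; last lia.
apply/zel_sop/IH => //; first exact: incrS hf; last lia.
by move=> j jk; have := fk j jk; lia.
Qed.

(** The later indices exceed i + 1, so d_(i+1) reaches position [j0] unchanged, where d_(i+1)
    s_(i+1) = id = d_(i+1) s_i. *)
Lemma dop_sops_swap f g k t i j0 : incr f k ->
  (forall j, (j < k)%N -> (f j <= deg t + j)%N) -> (j0 < k)%N ->
  (forall j, (j < k)%N -> j != j0 -> f j = g j) ->
  f j0 = i.+1 -> g j0 = i ->
  dop i.+1 (sops f k t) = dop i.+1 (sops g k t).
Proof.
elim: k => [//|k IH] hf hr; rewrite ltnS => jk hfg fi gi /=.
have hk : (f k <= deg t + k)%N by apply: hr.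
have hrk : forall j, (j < k)%N -> (f j <= deg t + j)%N by move=> j ?; apply: hr; lia.
have [e|ne] := eqVneq j0 k.
  have -> : sops g k t = sops f k t.
    by apply: eq_sops => j ltjk; rewrite hfg //; lia.
  rewrite -e fi gi dop_sop_id ?dop_sop_succ ?deg_sops //; subst j0; lia.
have ltk : (j0 < k)%N by lia.
have fk : (f j0 < f k)%N by apply: hf; lia.
rewrite -(hfg k) // 1?eq_sym // !dop_sop_lt ?deg_sops; [|lia..].
rewrite IH //; first exact: incrS hf.
by move=> j ltj; apply: hfg; lia.
Qed.

(** No degeneracy has the largest admissible index, so the top face passes each of them, loses one
    from its index each time, and remains a top face. *)
Lemma dop_sops_top f k t : (forall j, (j < k)%N -> (f j < deg t + j)%N) ->
  dop (deg t + k) (sops f k t) = sops f k (dop (deg t) t).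
Proof.
elim: k => [|k IH] h /=; first by rewrite addn0.
have := h k (leqnn _) => hk.
rewrite dop_sop_gt ?deg_sops; last lia.
by rewrite addnS /= IH // => j jk; apply: h; lia.
Qed.

End IteratedDegeneracies.

(** * Shuffles as pairs of increasing index families *)

Section ShufflePerm.
Context (n : nat).
Implicit Types (s : 'S_n).

(* [shuffle p q] for a permutation whose size is not syntactically p + q *)
Definition is_shuffle (p : nat) s : bool :=
  [forall a : 'I_n, forall b : 'I_n, (a < b)%N && ((b < p)%N || (p <= a)%N) ==>
                       (s a < s b)%N].

Lemma is_shuffleP p s :
  reflect (forall a b : 'I_n, (a < b)%N -> (b < p)%N || (p <= a)%N ->
           (s a < s b)%N) (is_shuffle p s).
Proof.
apply: (iffP forallP) => h a.
  by move=> b ab hp; have /forallP/(_ b)/implyP := h a; rewrite ab hp; apply.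
by apply/forallP => b; apply/implyP => /andP[]; exact: h.
Qed.

Lemma perm_nat_ord s (i : 'I_n) : perm_nat s i = s i :> nat.
Proof.
by rewrite /perm_nat (nth_map i) ?nth_ord_enum // size_enum_ord.
Qed.

Lemma perm_natE s i (h : (i < n)%N) : perm_nat s i = s (Ordinal h) :> nat.
Proof. by rewrite -perm_nat_ord. Qed.

Lemma perm_nat_lt s i : (i < n)%N -> (perm_nat s i < n)%N.
Proof. by move=> h; rewrite perm_natE ltn_ord. Qed.

Lemma shuffle_incrl p s : (p <= n)%N -> is_shuffle p s -> incr (perm_nat s) p.
Proof.
move=> pn /is_shuffleP h i j /andP[ij jp].
have jn : (j < n)%N by lia.
have in_ : (i < n)%N by lia.
by rewrite !perm_natE; apply: h => //=; rewrite jp.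
Qed.

Lemma shuffle_incrr p s : is_shuffle p s ->
  incr (fun i => perm_nat s (p + i)) (n - p).
Proof.
move=> /is_shuffleP h i j /andP[ij jp].
have jn : (p + j < n)%N by lia.
have in_ : (p + i < n)%N by lia.
by rewrite !perm_natE; apply: h => /=; lia.
Qed.

Lemma shuffle_rangel p s : (p <= n)%N -> is_shuffle p s ->
  forall j, (j < p)%N -> (perm_nat s j <= (n - p) + j)%N.
Proof.
move=> pn hs j jp.
have /incr_room/(_ _ j jp) := shuffle_incrl pn hs => /(_ n) h.
by have := h (fun i ip => perm_nat_lt s (leq_trans ip pn)); lia.
Qed.

Lemma shuffle_ranger p s : (p <= n)%N -> is_shuffle p s ->
  forall j, (j < n - p)%N -> (perm_nat s (p + j) <= p + j)%N.
Proof.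
move=> pn hs j jp.
have /incr_room/(_ _ j jp) := shuffle_incrr hs => /(_ n) h.
have : (perm_nat s (p + j) + (n - p - j) <= n)%N.
  by apply: h => i ip; apply: perm_nat_lt; lia.
lia.
Qed.

End ShufflePerm.

(** * Exchanging two consecutive values of a shuffle *)

Section ShuffleSwap.
Context (n p : nat) (pn : (p <= n.+1)%N) (i : nat) (a b : 'I_n.+1).
Context (ai : a = i :> nat) (bi : b = i.+1 :> nat).
Implicit Types (s : 'S_n.+1).

(** One of the degeneracies s_i, s_(i+1) is applied to [v] and the other to [w]. *)
Definition straddle s := ((s^-1)%g a < p)%N != ((s^-1)%g b < p)%N.

Let neq_ab : a != b.
Proof. by apply/eqP => e; have := bi; rewrite -e ai; lia. Qed.

(** Products of permutations apply the left factor first, so [s * tperm a b] exchanges the values i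
    and i + 1 of [s], not its arguments. *)
Lemma swap_invl s : ((s * tperm a b)^-1)%g a = (s^-1)%g b.
Proof. by rewrite invMg tpermV permM tpermL. Qed.

Lemma swap_invr s : ((s * tperm a b)^-1)%g b = (s^-1)%g a.
Proof. by rewrite invMg tpermV permM tpermR. Qed.

Lemma straddle_swap s : straddle (s * tperm a b)%g = straddle s.
Proof. by rewrite /straddle swap_invl swap_invr eq_sym. Qed.

(** Exchanging two consecutive values only affects the order of the pair that takes these values,
    and [straddle] puts this pair in different blocks. *)
Lemma shuffle_swap s : straddle s -> is_shuffle p s ->
  is_shuffle p (s * tperm a b)%g.
Proof.
move=> st /is_shuffleP hs; apply/is_shuffleP => c d cd hp.
have := hs c d cd hp; rewrite !permM.
have na : s c = a -> s d = b -> False.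
  move=> e e'; move: st; rewrite /straddle -e -e' !permK; case/orP: hp => h.
    by rewrite h (ltn_trans cd h) eqxx.
  by rewrite !ltnNge h (leq_trans h (ltnW cd)) eqxx.
move=> lt; case: tpermP => [e|e|/eqP n1 /eqP n2]; case: tpermP => [f|f|/eqP n3 /eqP n4] //.
- by move: lt; rewrite e f ltnn.
- by have := na e f.
- move: lt n4; rewrite e ai bi -val_eqE /= bi; lia.
- by move: lt; rewrite e f ai bi; lia.
- by move: lt; rewrite e f ltnn.
- by move: lt; rewrite e bi ai; lia.
- by move: lt; rewrite f ai bi; lia.
- by move: lt n1 ; rewrite f bi -val_eqE /= ai; lia.
Qed.

(** Each block contains exactly one of the values i, i + 1, so the exchange alters one index in each
    composite, and d_(i+1) does not see the alteration. *)
Lemma dop_shuffle_swap (T : psset) (v w : T) s :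
  deg v = p -> deg w = (n.+1 - p)%N -> straddle s -> is_shuffle p s ->
  (dop i.+1 (sops (fun i => perm_nat (s * tperm a b)%g (p + i)) (n.+1 - p) v)
    = dop i.+1 (sops (fun i => perm_nat s (p + i)) (n.+1 - p) v)) /\
  (dop i.+1 (sops (perm_nat (s * tperm a b)%g) p w)
    = dop i.+1 (sops (perm_nat s) p w)).
Proof.
move=> dv dw.
(* The swap is an involution, so one may assume that [a] is an image of the
   first [p] indices. *)
wlog lt : s / ((s^-1)%g a < p)%N => [IH|] st hs.
  have [lt|ge] := ltnP ((s^-1)%g a) p; first exact: IH.
  have tt : (s * tperm a b * tperm a b)%g = s.
    by rewrite -mulgA tperm2 mulg1.
  have lt' : (((s * tperm a b)^-1)%g a < p)%N.
    move: st; rewrite swap_invl /straddle ltnNge ge /=.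
    by case: (_ < p)%N.
  have [|e1 e2] := IH _ lt' _ (shuffle_swap st hs); first by rewrite straddle_swap.
  by move: e1 e2; rewrite tt => -> ->.
set t := (s * tperm a b)%g.
have ht : is_shuffle p t by exact: shuffle_swap.
have ge : (p <= (s^-1)%g b)%N.
  by move: st; rewrite /straddle lt; case: ltnP.
have other : forall j, (j < n.+1)%N -> j != (s^-1)%g a -> j != (s^-1)%g b ->
    perm_nat t j = perm_nat s j.
  move=> j jn ja jb; rewrite !(perm_natE _ jn) /t permM tpermD //.
    by apply: contra ja => /eqP ->; rewrite permK.
  by apply: contra jb => /eqP ->; rewrite permK.
have ta : perm_nat t ((s^-1)%g a) = i.+1.
  by rewrite perm_nat_ord /t permM permKV tpermL.
have tb : perm_nat t ((s^-1)%g b) = i.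
  by rewrite perm_nat_ord /t permM permKV tpermR.
have sa : perm_nat s ((s^-1)%g a) = i by rewrite perm_nat_ord permKV.
have sb : perm_nat s ((s^-1)%g b) = i.+1 by rewrite perm_nat_ord permKV.
have lb := ltn_ord ((s^-1)%g b).
split.
  (* On [v] it is [s] that has the value i + 1, and on [w] it is [t]; [dop_sops_swap] wants that
     family on the left. *)
  symmetry; apply: (@dop_sops_swap _ _ _ _ _ _ ((s^-1)%g b - p)).
  - exact: shuffle_incrr.
  - by rewrite dv; apply: shuffle_ranger.
  - lia.
  - move=> j jn jb; rewrite other //; lia.
  - by rewrite subnKC.
  - by rewrite subnKC.
apply: (@dop_sops_swap _ _ _ _ _ _ ((s^-1)%g a)).
- exact: shuffle_incrl.
- by rewrite dw; apply: shuffle_rangel.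
- by [].
- move=> j jn jb; rewrite other //; lia.
- by [].
- by [].
Qed.

End ShuffleSwap.

(** * Removing the largest value from a shuffle *)

Section ShuffleLift.
Context (n : nat).

Lemma lift_perm_surj (i j : 'I_n.+1) (s : 'S_n.+1) : s i = j ->
  exists s', s = lift_perm i j s'.
Proof.
move=> si.
(* The second factor sends [j] to [i] and preserves the order of the rest, so [r] fixes [i] and
   restricts to its complement. *)
pose r := (s * lift_perm j i 1)%g.
have ri : r i = i by rewrite permM si lift_perm_id.
(* The default [k] is never taken, since [r (lift i k)] differs from [i]. *)
pose f k := odflt k (unlift i (r (lift i k))).
have fK k : lift i (f k) = r (lift i k).
  rewrite /f; case: (unliftP i (r (lift i k))) => //= e.
  by have := neq_lift i k; rewrite -(inj_eq (@perm_inj _ r)) ri e eqxx.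
have finj : injective f.
  move=> k l e; apply: (@lift_inj _ i); apply: (@perm_inj _ r).
  by rewrite -!fK e.
exists (perm finj).
suff rE : lift_perm i i (perm finj) = r.
  rewrite -[perm finj]mulg1 -(lift_permM i i) rE /r -mulgA.
  by rewrite lift_permM mulg1 lift_perm1 mulg1.
apply/permP => k; case: (unliftP i k) => [k'|] ->.
  by rewrite lift_perm_lift permE fK.
by rewrite lift_perm_id ri.
Qed.

Lemma lift_perm_inj (i j : 'I_n.+1) : injective (@lift_perm n i j).
Proof.
move=> s t e; apply/permP => k; apply: (@lift_inj _ j).
by rewrite -!(lift_perm_lift i) e.
Qed.

(** The second hypothesis makes [i] the last element of its block, where the largest value imposes
    no condition; the first says that the blocks without [i] are cut at [q]. *)
Lemma shuffle_lift_max p q (i : 'I_n.+1) (s : 'S_n) :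
  (forall k : 'I_n, (lift i k < p)%N = (k < q)%N) ->
  (forall c : 'I_n.+1, (i < c)%N -> (i < p <= c)%N) ->
  is_shuffle p (lift_perm i ord_max s) = is_shuffle q s.
Proof.
move=> hpq hi; apply/is_shuffleP/is_shuffleP => h a b ab hp.
  have := h (lift i a) (lift i b); rewrite !lift_perm_lift !lift_max; apply.
    by rewrite /= /bump; lia.
  by rewrite hpq [(p <= _)%N]leqNgt hpq -leqNgt.
have nai : a != i.
  by apply/eqP => e; have := hi b; rewrite -e ab => /(_ isT); lia.
have [a' ea] : exists a', a = lift i a'.
  by case: (unliftP i a) => [a'|] e; [exists a'|rewrite e eqxx in nai].
subst a.
have [[b' eb]|eb] : (exists b', b = lift i b') \/ b = i.
  by case: (unliftP i b) => [b'|]; [left; exists b'|right].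
  subst b; rewrite !lift_perm_lift !lift_max; apply: h.
    by move: ab; rewrite /= /bump; lia.
  by move: hp; rewrite hpq [(p <= _)%N]leqNgt hpq -leqNgt.
by rewrite eb lift_perm_id lift_perm_lift lift_max /=.
Qed.

Lemma perm_nat_lift_max (i : 'I_n.+1) (s : 'S_n) j : (j < n)%N ->
  perm_nat (lift_perm i ord_max s) (bump i j) = perm_nat s j.
Proof.
move=> jn; rewrite (perm_natE _ jn) -(lift_max (s _)) -(lift_perm_lift i).
by rewrite -perm_nat_ord.
Qed.

Lemma sum_shuffle_lift_max (V : nmodType) p q (i : 'I_n.+1) (F : 'S_n.+1 -> V) :
  (forall k : 'I_n, (lift i k < p)%N = (k < q)%N) ->
  (forall c : 'I_n.+1, (i < c)%N -> (i < p <= c)%N) ->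
  \sum_(s : 'S_n.+1 | is_shuffle p s && (s i == ord_max)) F s =
  \sum_(s : 'S_n | is_shuffle q s) F (lift_perm i ord_max s).
Proof.
move=> hpq hi.
rewrite -[RHS](big_imset F (h := lift_perm i ord_max)
  (A := [pred s | is_shuffle q s])) /=; last by move=> s t _ _; apply: lift_perm_inj.
apply: eq_bigl => s; apply/andP/imsetP => [[hs /eqP si]|[s' hs' ->]].
  have [s' e] := lift_perm_surj si; exists s' => //=.
  by rewrite inE -(shuffle_lift_max _ hpq hi) -e.
by rewrite lift_perm_id eqxx (shuffle_lift_max _ hpq hi).
Qed.

(** A shuffle increases on each block, so its largest value is taken at the end of a block. *)
Lemma shuffle_max p (s : 'S_n.+1) (i : 'I_n.+1) : is_shuffle p s ->
  i = (if ((s^-1)%g ord_max < p)%N then p.-1 else n) :> nat ->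
  s i = ord_max.
Proof.
move=> /is_shuffleP hs hi.
have [->|ne] := eqVneq i ((s^-1)%g ord_max); first by rewrite permKV.
have lt : ((s^-1)%g ord_max < i)%N.
  move: ne hi; rewrite -val_eqE /=; have := ltn_ord ((s^-1)%g ord_max).
  by case: ifP; lia.
have := hs _ _ lt; rewrite permKV => /(_ _)/wrap[].
  by move: hi; case: ltnP; lia.
by have := ltn_ord (s i); rewrite /=; lia.
Qed.

End ShuffleLift.

(** * Shuffle sums of degenerate vectors and of faces *)

Section ShuffleSum.
Context (R : numDomainType) (T : psset).
Implicit Types (O : T -> T -> R) (v w : T).

Definition shuffle_term O n p v w (s : 'S_n) : R :=
  (-1) ^+ s * O (sops (fun i => perm_nat s (p + i)) (n - p) v)
                (sops (perm_nat s) p w).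

Definition shuffle_sum O n p v w : R :=
  \sum_(s : 'S_n | is_shuffle p s) shuffle_term O p v w s.

Lemma shuffle_sum_sop O n p i v w : (p < n)%N -> (i <= p)%N ->
  deg v = p -> deg w = (n - p.+1)%N ->
  (forall j t u, (j <= deg t)%N -> deg t = n.-1 -> deg u = n.-1 ->
    O (sop j t) (sop j u) = 0) ->
  shuffle_sum O n p.+1 (sop i v) w = 0.
Proof.
move=> pn ip dv dw hO; apply: big1 => s hs; rewrite /shuffle_term.
have [||a [u [du au na ->]]] := sops_sop_factor (shuffle_incrr hs) (t := v) (i := i).
- by rewrite dv; apply: shuffle_ranger.
- by rewrite dv.
have an : (a < n)%N by lia.
(* As [a] is not among the indices applied to the first vector, its preimage is in the first block;
   hence s_a also factors out of the composite on [w]. *)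
pose j : nat := (s^-1)%g (Ordinal an).
have sj : perm_nat s j = a by rewrite perm_nat_ord permKV.
have jp : (j < p.+1)%N.
  rewrite ltnNge; apply/negP => pj.
  have := na (j - p.+1)%N; rewrite subnKC // sj eqxx => /(_ _)/wrap[] //.
  by have := ltn_ord ((s^-1)%g (Ordinal an)); rewrite -/j; lia.
have [|u' [du' au' ->]] := sops_factor (shuffle_incrl pn hs) (t := w) _ jp.
  by rewrite dw; apply: shuffle_rangel.
by rewrite sj hO ?mulr0 //; lia.
Qed.

Section Boundary.
Context (O : T -> T -> R) (n p q : nat) (v w : T).
Context (pq : (p + q)%N = n.+1) (dv : deg v = p) (dw : deg w = q).
Context (hv : forall i, (i < p)%N -> zel (dop i v)).
Context (hw : forall i, (i < q)%N -> zel (dop i w)).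
Context (O0l : forall t u, zel t -> O t u = 0).
Context (O0r : forall t u, zel u -> O t u = 0).

Let Od i t u := O (dop i t) (dop i u).

Let pn : (p <= n.+1)%N. Proof. lia. Qed.
Let qE : q = (n.+1 - p)%N. Proof. lia. Qed.

(** When i - 1 and i (only i if i = 0) lie in one block, the composite given by the other block
    avoids both, and d_i turns it into zero. *)
Lemma shuffle_term_dop0 s i : is_shuffle p s -> (i <= n)%N ->
  (forall a : 'I_n.+1, (a == i :> nat) || (a.+1 == i) ->
    ((s^-1)%g a < p)%N) \/
  (forall a : 'I_n.+1, (a == i :> nat) || (a.+1 == i) ->
    (p <= (s^-1)%g a)%N) ->
  shuffle_term (Od i) p v w s = 0.
Proof.
move=> hs iN [] h; rewrite /shuffle_term /Od.
  rewrite O0l ?mulr0 //; apply: zel_dop_sops => //; try by rewrite ?dv; try lia.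
  - exact: shuffle_incrr.
  - by rewrite dv; apply: shuffle_ranger.
  - move=> j jn; have jn' : (p + j < n.+1)%N by lia.
    rewrite (perm_natE _ jn') -negb_or; apply/negP => /h.
    by rewrite permK /=; lia.
rewrite O0r ?mulr0 //; apply: zel_dop_sops => //; try by rewrite ?dw; try lia.
- exact: shuffle_incrl.
- by rewrite dw qE; apply: shuffle_rangel.
- move=> j jn; have jn' : (j < n.+1)%N by lia.
  rewrite (perm_natE _ jn') -negb_or; apply/negP => /h.
  by rewrite permK /=; lia.
Qed.

Lemma shuffle_sum_dop_bottom : shuffle_sum (Od 0) n.+1 p v w = 0.
Proof.
apply: big1 => s hs; apply: shuffle_term_dop0 => //.
have e (a : 'I_n.+1) : (a == 0 :> nat) || (a.+1 == 0) -> a = ord0.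
  by move=> h; apply: val_inj; move: h; rewrite /=; lia.
by case: (ltnP ((s^-1)%g ord0) p) => h; [left|right] => a /e ->.
Qed.

Lemma shuffle_sum_dop_mid i : (i < n)%N ->
  shuffle_sum (Od i.+1) n.+1 p v w = 0.
Proof.
move=> iN.
have iN1 : (i < n.+1)%N by lia.
pose a := Ordinal iN1; pose b := @Ordinal n.+1 i.+1 iN.
have ab (c : 'I_n.+1) : (c == i.+1 :> nat) || (c.+1 == i.+1) -> c = a \/ c = b.
  by case/orP => /eqP h; [right|left]; apply: val_inj => /=; lia.
(* The shuffles with i and i + 1 in the same block contribute zero. *)
rewrite /shuffle_sum (bigID (straddle p a b)) /= [X in _ + X]big1 ?addr0; last first.
  move=> s /andP[hs]; rewrite /straddle negbK => /eqP st.
  apply: shuffle_term_dop0 => //.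
  case: (ltnP ((s^-1)%g a) p) => h; [left|right] => c /ab[] -> //.
    by rewrite -st.
  by rewrite leqNgt -st -leqNgt.
have ea : a = i :> nat by [].
have eb : b = i.+1 :> nat by [].
set S := \sum_(s | _) _.
(* The exchange permutes the straddling shuffles, keeps the value of the form and flips the sign. *)
have SN : S = - S.
  rewrite /S [LHS](reindex_inj (mulIg (tperm a b))) /= -sumrN.
  apply: eq_big => [s|s].
    rewrite straddle_swap; case st : (straddle p a b s); rewrite ?andbF ?andbT //.
    apply/idP/idP => hs; last exact: (shuffle_swap pn ea eb).
    rewrite -[s]mulg1 -(tperm2 a b) mulgA; apply: (shuffle_swap pn ea eb) => //.
    by rewrite straddle_swap.
  rewrite straddle_swap // => /andP[hs' st].
  have hs : is_shuffle p s.
    rewrite -[s]mulg1 -(tperm2 a b) mulgA; apply: (shuffle_swap pn ea eb) => //.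
    by rewrite straddle_swap.
  rewrite /shuffle_term /Od.
  have [->->] := dop_shuffle_swap pn ea eb dv (etrans dw qE) st hs.
  rewrite odd_permM odd_tperm -val_eqE /= (_ : i != i.+1); last lia.
  by rewrite addbT; case: (odd_perm s); rewrite ?expr1 ?expr0 ?mulN1r ?mul1r ?opprK.
apply/eqP; have := SN => /eqP; rewrite -addr_eq0 -mulr2n mulrn_eq0 /=; exact.
Qed.

(** The degeneracy s_n is the outermost one on [w] (first summand) or on [v] (second summand). There
    d_(n+1) s_n = id, while on the other vector d_(n+1) becomes the top face. *)
Lemma shuffle_sum_dop_top : (-1) ^+ n.+1 * shuffle_sum (Od n.+1) n.+1 p v w =
  (if p is p'.+1 then (-1) ^+ p * shuffle_sum O n p' (dop p v) w else 0) +
  (if q is q'.+1 then (-1) ^+ n.+1 * shuffle_sum O n p v (dop q w) else 0).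
Proof.
rewrite /shuffle_sum (bigID (fun s : 'S_n.+1 => ((s^-1)%g ord_max < p)%N)) /= mulrDr.
congr (_ + _).
  move: pq dv hv pn qE; case: p => [|p'] pq' dv' hv' pn' qE'.
    by rewrite big1 ?mulr0 // => s; rewrite ltn0 andbF.
  pose i := Ordinal pn'.
  have h1 (k : 'I_n) : (lift i k < p'.+1)%N = (k < p')%N by rewrite /= /bump; lia.
  have h2 (c : 'I_n.+1) : (i < c)%N -> (i < p'.+1 <= c)%N by move=> /=; lia.
  rewrite (eq_bigl (fun s => is_shuffle p'.+1 s && (s i == ord_max))); last first.
    move=> s; case hs : (is_shuffle _ s) => //=.
    apply/idP/eqP => [h|si]; first by apply: (shuffle_max hs); rewrite h.
    by rewrite -si permK.
  rewrite (sum_shuffle_lift_max _ h1 h2) !big_distrr /=; apply: eq_bigr => s hs.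
  rewrite /shuffle_term /Od.
  have dlt (j : nat) : (j < n - p')%N ->
      perm_nat (lift_perm i ord_max s) (p'.+1 + j) = perm_nat s (p' + j).
    by move=> jn; rewrite -(perm_nat_lift_max i) /bump //=; [congr perm_nat|]; lia.
  have -> : sops (perm_nat (lift_perm i ord_max s)) p'.+1 w =
      sop n (sops (perm_nat s) p' w).
    rewrite /= -[X in perm_nat _ X]/(i : nat) perm_nat_ord lift_perm_id /=.
    congr sop; apply: eq_sops => j jp; rewrite -(perm_nat_lift_max i); last lia.
    by congr perm_nat; rewrite /bump /=; lia.
  rewrite dop_sop_succ; last by rewrite deg_sops; lia.
  rewrite subSS (eq_sops _ dlt) [X in dop X]( _ : n.+1 = deg v + (n - p'))%N; last lia.
  rewrite dop_sops_top ?dv'; last first.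
    by move=> j jn; have := shuffle_ranger (ltnW _) hs jn => /(_ _)/wrap[]; lia.
  rewrite !mulrA; congr (_ * _).
  (* Removing the value n at position p' changes the sign by (-1)^(n+p'), which with (-1)^(n+1)
     leaves (-1)^(p'+1). *)
  rewrite -(signr_odd _ n.+1) -(signr_odd _ p'.+1) -!signr_addb odd_lift_perm /=.
  by case: (odd_perm s); case: (odd n); case: (odd p').
move: pq dw hw qE; case: q => [|q'] pq' dw' hw' qE'.
  rewrite big1 ?mulr0 // => s /andP[_].
  by have := ltn_ord ((s^-1)%g ord_max); lia.
have pn' : (p <= n)%N by lia.
have h1 (k : 'I_n) : (lift ord_max k < p)%N = (k < p)%N by rewrite lift_max.
have h2 (c : 'I_n.+1) : ((ord_max : 'I_n.+1) < c)%N -> ((ord_max : 'I_n.+1) < p <= c)%N.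
  by have := ltn_ord c => /=; lia.
rewrite (eq_bigl (fun s : 'S_n.+1 => is_shuffle p s && (s ord_max == ord_max))); last first.
  move=> s; case hs : (is_shuffle _ s) => //=.
  apply/idP/eqP => [h|si]; last by rewrite -{1}si permK -leqNgt.
  by apply: (shuffle_max hs); rewrite (negbTE h).
rewrite (sum_shuffle_lift_max _ h1 h2) !big_distrr /=; apply: eq_bigr => s hs.
rewrite /shuffle_term /Od.
have low (j : nat) : (j < n)%N -> perm_nat (lift_perm ord_max ord_max s) j = perm_nat s j.
  move=> jn; rewrite -(perm_nat_lift_max ord_max s) //.
  by congr perm_nat; rewrite /bump /=; lia.
have -> : sops (perm_nat (lift_perm ord_max ord_max s)) p w = sops (perm_nat s) p w.
  by apply: eq_sops => j jp; apply: low; lia.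
rewrite subSn //= subnKC // -[X in perm_nat _ X]/((ord_max : 'I_n.+1) : nat).
rewrite perm_nat_ord lift_perm_id /= dop_sop_succ; last by rewrite deg_sops; lia.
rewrite (eq_sops (g := fun i => perm_nat s (p + i))); last first.
  by move=> j jn; apply: low; lia.
rewrite [X in dop X (sops _ p _)]( _ : n.+1 = deg w + p)%N; last lia.
rewrite dop_sops_top ?dw'; last first.
  by move=> j jn; have := shuffle_rangel pn' hs jn; lia.
rewrite !mulrA; congr (_ * _).
(* Here the value n is removed at position n, so the sign of the shuffle is unchanged. *)
rewrite -(signr_odd _ n.+1) -!signr_addb odd_lift_perm /=.
by case: (odd_perm s); case: (odd n).
Qed.

Lemma shuffle_sum_boundary :
  \sum_(i < n.+2) (-1) ^+ i * shuffle_sum (Od i) n.+1 p v w =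
  (if p is p'.+1 then (-1) ^+ p * shuffle_sum O n p' (dop p v) w else 0) +
  (if q is q'.+1 then (-1) ^+ n.+1 * shuffle_sum O n p v (dop q w) else 0).
Proof.
rewrite big_ord_recr big_ord_recl /= -shuffle_sum_dop_top.
rewrite shuffle_sum_dop_bottom mulr0 add0r big1 ?add0r // => i _.
by rewrite /bump add1n shuffle_sum_dop_mid ?mulr0.
Qed.

End Boundary.
End ShuffleSum.

(** * Tangent maps *)

Section TangentMaps.
Local Open Scope classical_set_scope.

(** The first-order expansion of [f] is also one of [g]. Only local agreement can be expected of
    expressions in charts, as the charts are inverted only on their domains. *)
Lemma near_eq_diff (R : realType) (E F : normedModType R) (f g : E -> F) (x : E) :
  (\forall y \near x, f y = g y) -> differentiable f x ->
  differentiable g x /\ 'd g x = 'd f x :> (E -> F).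
Proof.
move=> fg df; have fgx : f x = g x by exact: nbhs_singleton fg.
have e : g \o shift x = cst (g x) + 'd f x +o_ 0 id.
  apply/eqaddoP => eps eps0.
  have /eqaddoP/(_ _ eps0) := diff_locally df.
  have fg0 : \forall h \near (0 : E), f (h + x) = g (h + x).
    by move: fg; rewrite (near_shift 0 x) /= subr0.
  by apply: filterS2 fg0 => h; rewrite /= -fgx !fctE => ->.
have d := diff_unique (diff_continuous df) e.
split=> //; apply/diff_locallyP; rewrite d; split=> //.
exact: diff_continuous.
Unshelve. all: by end_near. Qed.

Context {R : realType}.
Implicit Types (M N P : manifold R).

(* The regularity of a map at a point under which the chain rule for [tmap]
   holds; unlike [smooth_map], it is obviously stable under composition. *)
Definition tdiff M N (f : M -> N) (x : M) : Prop :=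
  {for x, continuous f} /\
  differentiable (phi N (chart_at N (f x)) \o f \o phiV M (chart_at M x))
    (phi M (chart_at M x) x).

Lemma smooth_tdiff M N (f : M -> N) x : smooth_map f -> tdiff f x.
Proof.
move=> [fc fs]; split; first exact: fc.
have [+ _] := fs (chart_at M x) (chart_at N (f x)) 1%N; apply.
by exists x => //; split; apply: chart_at_dom.
Qed.

Lemma phi_chart_atK M (x : M) : phiV M (chart_at M x) (phi M (chart_at M x) x) = x.
Proof. exact/phiK/chart_at_dom. Qed.

Lemma phiV_continuous_at M (x : M) :
  {for phi M (chart_at M x) x, continuous (phiV M (chart_at M x))}.
Proof. by apply: phiV_continuous; exists x => //; apply: chart_at_dom. Qed.

Lemma tdiff_near M N (f : M -> N) (x : M) : {for x, continuous f} ->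
  \forall a \near phi M (chart_at M x) x,
    phiV N (chart_at N (f x)) (phi N (chart_at N (f x)) (f (phiV M (chart_at M x) a)))
    = f (phiV M (chart_at M x) a).
Proof.
move=> fc.
have c : {for phi M (chart_at M x) x, continuous (f \o phiV M (chart_at M x))}.
  apply: continuous_comp; first exact: phiV_continuous_at.
  by rewrite phi_chart_atK.
have o : nbhs (f x) (dom N (chart_at N (f x))).
  by apply: open_nbhs_nbhs; split; [exact: dom_open|exact: chart_at_dom].
have h : \forall a \near phi M (chart_at M x) x,
    dom N (chart_at N (f x)) (f (phiV M (chart_at M x) a)).
  by apply: c; rewrite /= phi_chart_atK.
by apply: filterS h => a /= /phiK.
Qed.

(** Chain rule: by continuity [f] stays in the chart domain around [f x], so near the point the
    local expression of [g \o f] is the composite of the local expressions. *)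
Lemma tdiff_comp_diff M N P (f : M -> N) (g : N -> P) (x : M) :
  tdiff f x -> tdiff g (f x) ->
  differentiable (phi P (chart_at P (g (f x))) \o (g \o f) \o phiV M (chart_at M x))
    (phi M (chart_at M x) x) /\
  'd (phi P (chart_at P (g (f x))) \o (g \o f) \o phiV M (chart_at M x))
    (phi M (chart_at M x) x) =
  @tmap _ _ _ g (f x) (g (f x)) \o @tmap _ _ _ f x (f x) :> (tangent x -> tangent (g (f x))).
Proof.
move=> [fc fd] [gc gd].
pose F := phi N (chart_at N (f x)) \o f \o phiV M (chart_at M x).
pose G := phi P (chart_at P (g (f x))) \o g \o phiV N (chart_at N (f x)).
have Fx : F (phi M (chart_at M x) x) = phi N (chart_at N (f x)) (f x).
  by rewrite /F /= phi_chart_atK.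
have gd' : differentiable G (F (phi M (chart_at M x) x)) by rewrite Fx.
have nearE : \forall a \near phi M (chart_at M x) x, (G \o F) a =
    (phi P (chart_at P (g (f x))) \o (g \o f) \o phiV M (chart_at M x)) a.
  by apply: filterS (tdiff_near fc) => a; rewrite /G /F /= => ->.
have [d e] := near_eq_diff nearE (differentiable_comp fd gd').
by split=> //; rewrite e diff_comp // Fx.
Qed.

Lemma tdiff_comp M N P (f : M -> N) (g : N -> P) (x : M) :
  tdiff f x -> tdiff g (f x) -> tdiff (g \o f) x.
Proof.
move=> df dg; split; last by have [] := tdiff_comp_diff df dg.
by apply: continuous_comp; [exact: df.1|exact: dg.1].
Qed.

Lemma tmap_comp M N P (f : M -> N) (g : N -> P) x y z :
  f x = y -> g y = z -> tdiff f x -> tdiff g y ->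
  forall v : tangent x, tmap (g \o f) z v = tmap g z (tmap f y v).
Proof.
move=> <- <- df dg v; have [_] := tdiff_comp_diff df dg.
by rewrite /tmap => ->.
Qed.

(** This carries each simplicial identity over to tangent maps, without transport between tangent
    spaces at provably equal points. *)
Lemma tmap_square M N N' P (f : M -> N) (g : N -> P) (f' : M -> N') (g' : N' -> P)
    x y y' z :
  g \o f = g' \o f' ->
  f x = y -> g y = z -> f' x = y' -> g' y' = z ->
  tdiff f x -> tdiff g y -> tdiff f' x -> tdiff g' y' ->
  forall v : tangent x, tmap g z (tmap f y v) = tmap g' z (tmap f' y' v).
Proof.
move=> e e1 e2 e3 e4 d1 d2 d3 d4 v.
by rewrite -(tmap_comp e1 e2 d1 d2) -(tmap_comp e3 e4 d3 d4) e.
Qed.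

Lemma near_chart_id M (x : M) :
  \forall a \near phi M (chart_at M x) x,
    a = phi M (chart_at M x) (phiV M (chart_at M x) a).
Proof.
have o : nbhs (phi M (chart_at M x) x) (phi M (chart_at M x) @` dom M (chart_at M x)).
  apply: open_nbhs_nbhs; split; first exact: img_open.
  by exists x => //; apply: chart_at_dom.
by apply: filterS o => a [y dy <-]; rewrite phiK.
Qed.

Lemma diff_chart_id M (x : M) (v : tangent x) :
  'd (phi M (chart_at M x) \o phiV M (chart_at M x)) (phi M (chart_at M x) x) v = v.
Proof.
have [|_ e] := near_eq_diff (f := id) (near_chart_id x) _; first exact: ex_diff.
by have := congr1 (@^~ v) e; rewrite diff_val.
Qed.

Lemma tmap_id M (x : M) (v : tangent x) : tmap id x v = v.
Proof. exact: diff_chart_id. Qed.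

Lemma tdiff_id M (x : M) : tdiff id x.
Proof.
split; first exact: cvg_id.
have [|d _] := near_eq_diff (near_chart_id x) _; first exact: ex_diff.
exact: d.
Qed.

Lemma tmap_retract M N (f : M -> N) (g : N -> M) x y :
  g \o f = id -> f x = y -> g y = x -> tdiff f x -> tdiff g y ->
  forall v : tangent x, tmap g x (tmap f y v) = v.
Proof.
by move=> e e1 e2 d1 d2 v; rewrite -(tmap_comp e1 e2 d1 d2) e tmap_id.
Qed.

Lemma tmap_linear M N (f : M -> N) x y : linear (@tmap R M N f x y).
Proof. by move=> a u v; rewrite /tmap linearP. Qed.

Lemma tmap_bounded M N (f : M -> N) x y : f x = y -> tdiff f x ->
  exists C, 0 <= C /\ forall v : tangent x, `|tmap f y v| <= C * `|v|.
Proof.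
move=> <- [_ d].
have /linear_bounded_continuous/linear_boundedP := diff_continuous d.
move=> /pinfty_ex_gt0[C C0 h]; exists C; split; first exact: ltW.
exact: h.
Qed.

End TangentMaps.

(** * The simplicial vector space of tangent vectors at a point of X_0 *)

Section TangentSimplicial.
Context {R : realType} (X : smanifold R) (x : X 0%N).

Lemma dgn_dgn0 l i : (i <= l)%N -> dgn X i (dgn0 l x) = dgn0 l.+1 x.
Proof.
elim: l i => [|l IH] [|i] //= il.
by rewrite -dgn_dgn // IH.
Qed.

Lemma face_dgn0 l i : (i <= l.+1)%N -> face X i (dgn0 l.+1 x) = dgn0 l x.
Proof.
elim: l i => [|l IH] [|[|i]] //= il; try by have [] := @face_dgn_id _ X _ 0 (dgn0 l x).
- by have [] := @face_dgn_id _ X _ 0 x.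
- by have [] := @face_dgn_id _ X _ 0 x.
- by have [] := @face_dgn_id _ X _ 0 (dgn X 0 (dgn0 l x)).
- by have [] := @face_dgn_id _ X _ 0 (dgn X 0 (dgn0 l x)).
by rewrite face_dgn_gt // IH.
Qed.

Lemma face_tdiff l i (y : X l.+1) : (i <= l.+1)%N -> tdiff (@face _ X l i) y.
Proof. by move=> il; apply/smooth_tdiff/face_smooth. Qed.

Lemma dgn_tdiff l i (y : X l) : (i <= l)%N -> tdiff (@dgn _ X l i) y.
Proof. by move=> il; apply/smooth_tdiff/dgn_smooth. Qed.

Lemma tgt_face_linear l i : linear (@tgt_face R X x l i).
Proof. exact: tmap_linear. Qed.

Lemma tgt_dgn_linear l i : linear (@tgt_dgn R X x l i).
Proof. exact: tmap_linear. Qed.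

Lemma linear_map0 (U V : lmodType R) (f : U -> V) : linear f -> f 0 = 0.
Proof. by move=> /(_ (-1) 0 0); rewrite scaler0 addr0 scaleN1r addNr. Qed.

Lemma tgt_dgn_dgn l i j (v : tgt x l) : (i <= j <= l)%N ->
  tgt_dgn i (tgt_dgn j v) = tgt_dgn j.+1 (tgt_dgn i v).
Proof.
move=> h; have /andP[ij jl] := h; have il := leq_trans ij jl.
apply: tmap_square; [|exact: dgn_dgn0|apply: dgn_dgn0|exact: dgn_dgn0
  |exact: dgn_dgn0|exact: dgn_tdiff|apply: dgn_tdiff|exact: dgn_tdiff
  |exact: dgn_tdiff]; try exact: leqW.
by apply/funext => y; apply: dgn_dgn.
Qed.

Lemma tgt_face_dgn_lt l i j (v : tgt x l.+1) : (i < j <= l.+1)%N ->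
  tgt_face i (tgt_dgn j v) = tgt_dgn j.-1 (tgt_face i v).
Proof.
move=> h; have [il jl] : (i <= l.+1)%N /\ (j.-1 <= l)%N by lia.
have /andP[_ jl'] := h; have il' : (i <= l.+2)%N by lia.
apply: tmap_square; [|exact: dgn_dgn0|exact: face_dgn0|exact: face_dgn0
  |exact: dgn_dgn0|exact: dgn_tdiff|exact: face_tdiff|exact: face_tdiff
  |exact: dgn_tdiff].
by apply/funext => y; apply: face_dgn_lt.
Qed.

Lemma tgt_face_dgn_id l j (v : tgt x l) : (j <= l)%N ->
  tgt_face j (tgt_dgn j v) = v.
Proof.
move=> jl; have jl' := leqW jl.
apply: tmap_retract; [|exact: dgn_dgn0|exact: face_dgn0|exact: dgn_tdiff
  |exact: face_tdiff].
by apply/funext => y; have [] := face_dgn_id y jl.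
Qed.

Lemma tgt_face_dgn_succ l j (v : tgt x l) : (j <= l)%N ->
  tgt_face j.+1 (tgt_dgn j v) = v.
Proof.
move=> jl.
apply: tmap_retract; [|exact: dgn_dgn0|exact: face_dgn0|exact: dgn_tdiff
  |exact: face_tdiff].
by apply/funext => y; have [] := face_dgn_id y jl.
Qed.

Lemma tgt_face_dgn_gt l i j (v : tgt x l.+1) : (j.+1 < i <= l.+2)%N ->
  tgt_face i (tgt_dgn j v) = tgt_dgn j (tgt_face i.-1 v).
Proof.
move=> h; have [il jl] : (i.-1 <= l.+1)%N /\ (j <= l)%N by lia.
have /andP[_ il'] := h; have jl' := leqW jl.
apply: tmap_square; [|exact: dgn_dgn0|exact: face_dgn0|exact: face_dgn0
  |exact: dgn_dgn0|exact: dgn_tdiff|exact: face_tdiff|exact: face_tdiff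
  |exact: dgn_tdiff].
by apply/funext => y; apply: face_dgn_gt.
Qed.

Definition tvec := {l : nat & tgt x l}.
Definition tvec_deg (t : tvec) : nat := projT1 t.
Definition tvec_zero (t : tvec) : Prop := projT2 t = 0.
Definition tvec_dgn (i : nat) (t : tvec) : tvec :=
  let: existT l v := t in existT (tgt x) l.+1 (tgt_dgn i v).
(** In degree 0 the vector itself is a dummy value, consistent with [0.-1 = 0] in [deg_dop]. *)
Definition tvec_face (i : nat) (t : tvec) : tvec :=
  let: existT l v := t in
  match l return tgt x l -> tvec with
  | 0 => fun v => existT (tgt x) 0 v
  | l'.+1 => fun v => existT (tgt x) l' (tgt_face i v)
  end v.

Fact tvec_deg_dgn i t : tvec_deg (tvec_dgn i t) = (tvec_deg t).+1.
Proof. by case: t. Qed.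

Fact tvec_deg_face i t : tvec_deg (tvec_face i t) = (tvec_deg t).-1.
Proof. by case: t => -[]. Qed.

Fact tvec_zero_dgn i t : tvec_zero t -> tvec_zero (tvec_dgn i t).
Proof.
case: t => l v; rewrite /tvec_zero /tvec_dgn [projT2 _]/= => ->.
exact/linear_map0/tgt_dgn_linear.
Qed.

Fact tvec_dgn_dgn i j t : (i <= j <= tvec_deg t)%N ->
  tvec_dgn i (tvec_dgn j t) = tvec_dgn j.+1 (tvec_dgn i t).
Proof.
by case: t => l v h; exact (congr1 (existT (tgt x) l.+2) (tgt_dgn_dgn v h)).
Qed.

Fact tvec_face_dgn_lt i j t : (i < j <= tvec_deg t)%N ->
  tvec_face i (tvec_dgn j t) = tvec_dgn j.-1 (tvec_face i t).
Proof.
case: t => -[|l] v h; last exact (congr1 (existT (tgt x) l.+1) (tgt_face_dgn_lt v h)).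
by case/andP: h; case: j.
Qed.

Fact tvec_face_dgn_id j t : (j <= tvec_deg t)%N -> tvec_face j (tvec_dgn j t) = t.
Proof.
by case: t => l v h; exact (congr1 (existT (tgt x) l) (tgt_face_dgn_id v h)).
Qed.

Fact tvec_face_dgn_succ j t : (j <= tvec_deg t)%N ->
  tvec_face j.+1 (tvec_dgn j t) = t.
Proof.
by case: t => l v h; exact (congr1 (existT (tgt x) l) (tgt_face_dgn_succ v h)).
Qed.

Fact tvec_face_dgn_gt i j t : (j.+1 < i <= (tvec_deg t).+1)%N ->
  tvec_face i (tvec_dgn j t) = tvec_dgn j (tvec_face i.-1 t).
Proof.
case: t => -[|l] v h; last exact (congr1 (existT (tgt x) l.+1) (tgt_face_dgn_gt v h)).
by case/andP: h; case: i => [|[]].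
Qed.

Definition tvec_psset : psset :=
  PSSet tvec_deg_dgn tvec_deg_face tvec_zero_dgn tvec_dgn_dgn tvec_face_dgn_lt
    tvec_face_dgn_id tvec_face_dgn_succ tvec_face_dgn_gt.

Lemma dgns_dgn0 f k l : (forall j, (j < k)%N -> (f j <= l + j)%N) ->
  dgns f k (dgn0 l x) = dgn0 (k + l) x.
Proof.
elim: k => [//|k IH] h /=; rewrite IH ?dgn_dgn0 //; first by have := h k; lia.
by move=> j jk; apply: h; lia.
Qed.

Lemma dgns_tdiff f k l (y : X l) : (forall j, (j < k)%N -> (f j <= l + j)%N) ->
  tdiff (dgns f k (l := l)) y.
Proof.
elim: k => [|k IH] h /=; first exact: tdiff_id.
apply: (@tdiff_comp _ _ _ _ (dgns f k (l := l)) (dgn X (f k))).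
  by apply: IH => j jk; apply: h; lia.
by apply: dgn_tdiff; have := h k; lia.
Qed.

(** By the chain rule, the tangent map of an iterated degeneracy is the composite of degeneracies in
    [tvec_psset]; the equation between pairs hides the degrees. *)
Lemma tmap_dgns f k l (v : tgt x l) : (forall j, (j < k)%N -> (f j <= l + j)%N) ->
  existT (tgt x) (k + l)%N (tmap (dgns f k (l := l)) (dgn0 (k + l) x) v) =
  sops (T := tvec_psset) f k (existT (tgt x) l v).
Proof.
elim: k => [|k IH] h; first by rewrite tmap_id.
have h' j : (j < k)%N -> (f j <= l + j)%N by move=> jk; apply: h; lia.
have hk : (f k <= k + l)%N by have := h k; lia.
change (sops f k.+1 (existT (tgt x) l v : tvec_psset)) with
  (tvec_dgn (f k) (sops f k (existT (tgt x) l v : tvec_psset))).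
rewrite -(IH h').
exact (congr1 (existT (tgt x) (k.+1 + l)%N)
  (tmap_comp (dgns_dgn0 h') (dgn_dgn0 hk) (dgns_tdiff _ h') (dgn_tdiff _ hk) v)).
Qed.

Lemma tmap_dgns_cast f k l (e : (k + l)%N = (l + k)%N) (v : tgt x l) :
  (forall j, (j < k)%N -> (f j <= l + j)%N) ->
  existT (tgt x) (l + k)%N
    (tmap (fun y : X l => ecast n (X n) e (dgns f k y)) (dgn0 (l + k) x) v) =
  sops (T := tvec_psset) f k (existT (tgt x) l v).
Proof. by move=> h; case: _ / e; exact: tmap_dgns. Qed.

Lemma tmap_dgns_cast_bounded f k l (e : (k + l)%N = (l + k)%N) :
  (forall j, (j < k)%N -> (f j <= l + j)%N) ->
  exists C, 0 <= C /\ forall v : tgt x l,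
    `|tmap (fun y : X l => ecast n (X n) e (dgns f k y)) (dgn0 (l + k) x) v|
      <= C * `|v|.
Proof.
move=> h; case: _ / e; apply: tmap_bounded; last exact: dgns_tdiff.
exact: dgns_dgn0.
Qed.

End TangentSimplicial.

(** * Bounded bilinear forms *)

(** The conditions of [graded_map], on whole spaces instead of the fibres of the tangent complex. *)
Definition bounded_bilinear (R : realType) (E F : normedModType R) (b : E -> F -> R) :=
  [/\ forall (c : R) v v' w, b (c *: v + v') w = c * b v w + b v' w,
      forall (c : R) v w w', b v (c *: w + w') = c * b v w + b v w'
    & exists C : R, forall v w, `|b v w| <= C * `|v| * `|w|].

Section BoundedBilinear.
Context {R : realType}.
Implicit Types (E F : normedModType R).

Lemma bilinear_scale E F (b : E -> F -> R) c d v w :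
  (forall (c : R) v v' w, b (c *: v + v') w = c * b v w + b v' w) ->
  (forall (c : R) v w w', b v (c *: w + w') = c * b v w + b v w') ->
  b (c *: v) (d *: w) = c * d * b v w.
Proof.
move=> bl br.
have b0l u : b 0 u = 0.
  by have := bl (-1) 0 0 u; rewrite scaler0 addr0 mulN1r addNr.
have b0r u : b u 0 = 0.
  by have := br (-1) u 0 0; rewrite scaler0 addr0 mulN1r addNr.
by rewrite -[c *: v]addr0 bl b0l addr0 -[d *: w]addr0 br b0r addr0 mulrA.
Qed.

(** Rescaling nonzero [v] and [w] to norm e / 2 gives the constant (2 / e)^2. *)
Lemma bounded_bilinear_near0 E F (b : E -> F -> R) :
  (forall (c : R) v v' w, b (c *: v + v') w = c * b v w + b v' w) ->
  (forall (c : R) v w w', b v (c *: w + w') = c * b v w + b v w') ->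
  (exists2 e : R, 0 < e & forall v w, `|v| < e -> `|w| < e -> `|b v w| <= 1) ->
  bounded_bilinear b.
Proof.
move=> bl br [e e0 he]; split=> //; exists ((2 / e) ^+ 2) => v w.
have C0 : 0 <= (2 / e) ^+ 2 by rewrite exprn_ge0 // divr_ge0 // ltW.
have [v0|v0] := eqVneq v 0.
  have := bilinear_scale 0 1 v w bl br.
  rewrite v0 scale0r scale1r !mul0r => ->; rewrite normr0.
  by apply: mulr_ge0 => //; apply: mulr_ge0.
have [w0|w0] := eqVneq w 0.
  have := bilinear_scale 1 0 v w bl br.
  rewrite w0 scale0r scale1r mulr0 mul0r => ->; rewrite normr0.
  by apply: mulr_ge0 => //; apply: mulr_ge0.
have small (G : normedModType R) (u : G) : u != 0 -> `|(e / 2 / `|u|) *: u| < e.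
  move=> u0; rewrite normrZ ger0_norm; last by rewrite !divr_ge0 // ltW.
  by rewrite divfK ?normr_eq0 // ltr_pdivrMr // ltr_pMr // ltr1n.
have := he _ _ (small _ _ v0) (small _ _ w0).
rewrite bilinear_scale // normrM ger0_norm; last first.
  by rewrite mulr_ge0 // !divr_ge0 // ltW.
have vn : `|v| != 0 by rewrite normr_eq0.
have wn : `|w| != 0 by rewrite normr_eq0.
have en : e != 0 by rewrite gt_eqF.
rewrite -ler_pdivlMl; last by rewrite mulr_gt0 // !divr_gt0 // normr_gt0.
rewrite mulr1 => /le_trans; apply; rewrite le_eqVlt; apply/orP; left; apply/eqP.
by field; rewrite vn wn en.
Qed.

Lemma bounded_bilinear0 E F : bounded_bilinear (fun (_ : E) (_ : F) => 0 : R).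
Proof.
split=> [*|*|]; rewrite ?mulr0 ?addr0 //.
by exists 0 => v w; rewrite normr0 !mul0r.
Qed.

Lemma bounded_bilinearD E F (a b : E -> F -> R) :
  bounded_bilinear a -> bounded_bilinear b ->
  bounded_bilinear (fun v w => a v w + b v w).
Proof.
move=> [al ar [C aC]] [bl br [D bD]]; split=> [c v v' w|c v w w'|].
- by rewrite al bl; ring.
- by rewrite ar br; ring.
exists (C + D) => v w; apply: (le_trans (ler_normD _ _)).
by rewrite !mulrDl lerD.
Qed.

Lemma bounded_bilinearZ E F (c : R) (a : E -> F -> R) :
  bounded_bilinear a -> bounded_bilinear (fun v w => c * a v w).
Proof.
move=> [al ar [C aC]]; split=> [d v v' w|d v w w'|].
- by rewrite al; ring.
- by rewrite ar; ring.
exists (`|c| * C) => v w; rewrite normrM -!mulrA ler_wpM2l //.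
by rewrite mulrA.
Qed.

Lemma bounded_bilinear_sum E F (I : Type) (r : seq I) (P : pred I)
    (b : I -> E -> F -> R) :
  (forall i, P i -> bounded_bilinear (b i)) ->
  bounded_bilinear (fun v w => \sum_(i <- r | P i) b i v w).
Proof.
move=> h; elim: r => [|i r IH].
  have -> : (fun v w => \sum_(i <- [::] | P i) b i v w) = (fun (_ : E) (_ : F) => 0).
    by apply/funext => v; apply/funext => w; rewrite big_nil.
  exact: bounded_bilinear0.
have -> : (fun v w => \sum_(i <- i :: r | P i) b i v w) = (fun v w =>
    (if P i then b i v w else 0) + \sum_(i <- r | P i) b i v w).
  by apply/funext => v; apply/funext => w; rewrite big_cons; case: ifP; rewrite ?add0r.
apply: bounded_bilinearD => //.
by have := h i; case: (P i) => [|_]; [exact|exact: bounded_bilinear0].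
Qed.

Lemma bounded_bilinear_comp E F E' F' (b : E' -> F' -> R) (f : E -> E') (g : F -> F') :
  bounded_bilinear b -> linear f -> linear g ->
  (exists C, 0 <= C /\ forall v, `|f v| <= C * `|v|) ->
  (exists C, 0 <= C /\ forall v, `|g v| <= C * `|v|) ->
  bounded_bilinear (fun v w => b (f v) (g w)).
Proof.
move=> [bl br [C bC]] fl gl [A [A0 fA]] [B [B0 gB]].
split=> [c v v' w|c v w w'|]; rewrite ?fl ?gl //.
(* The constant [C] of [b] may be negative, hence the absolute value. *)
exists (`|C| * A * B) => v w; apply: (le_trans (bC _ _)).
have -> : `|C| * A * B * `|v| * `|w| = `|C| * (A * `|v|) * (B * `|w|) by ring.
apply: (@le_trans _ _ (`|C| * `|f v| * `|g w|)).
  by rewrite !ler_wpM2r // ler_norm.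
by rewrite ler_pM // ?mulr_ge0 // ler_wpM2l.
Qed.

End BoundedBilinear.

(** * Values of 2-forms on vectors at a point *)

Section TwoForms.
Context {R : realType}.
Implicit Types (M : manifold R).

Lemma vec2_dfwithl (E : lmodType R) (u v w : E) :
  vec2 v w = @dfwith 'I_2 (fun=> E) (vec2 u w) ord0 v.
Proof.
apply/funext => i; case: dfwithP => [|j]; first by rewrite /vec2 eqxx.
by rewrite /vec2 eq_sym => /negbTE ->.
Qed.

Lemma vec2_dfwithr (E : lmodType R) (u v w : E) :
  vec2 v w = @dfwith 'I_2 (fun=> E) (vec2 v u) ord_max w.
Proof.
apply/funext => i; case: dfwithP => [|j]; first by rewrite /vec2.
by rewrite /vec2; case: j => -[|[]].
Qed.

Lemma multilinear_vec2l (E : lmodType R) (f : ('I_2 -> E) -> R) : multilinear f ->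
  forall (c : R) v v' w, f (vec2 (c *: v + v') w) = c * f (vec2 v w) + f (vec2 v' w).
Proof.
move=> h c v v' w.
by rewrite (vec2_dfwithl 0 (_ + _)) (vec2_dfwithl 0 v) (vec2_dfwithl 0 v') h.
Qed.

Lemma multilinear_vec2r (E : lmodType R) (f : ('I_2 -> E) -> R) : multilinear f ->
  forall (c : R) v w w', f (vec2 v (c *: w + w')) = c * f (vec2 v w) + f (vec2 v w').
Proof.
move=> h c v w w'.
by rewrite (vec2_dfwithr 0 _ (_ + _)) (vec2_dfwithr 0 _ w) (vec2_dfwithr 0 _ w') h.
Qed.

Lemma multilinear_vec20l (E : lmodType R) (f : ('I_2 -> E) -> R) w :
  multilinear f -> f (vec2 0 w) = 0.
Proof.
move=> /multilinear_vec2l/(_ (-1) 0 0 w).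
by rewrite scaler0 addr0 mulN1r addNr.
Qed.

Lemma multilinear_vec20r (E : lmodType R) (f : ('I_2 -> E) -> R) v :
  multilinear f -> f (vec2 v 0) = 0.
Proof.
move=> /multilinear_vec2r/(_ (-1) v 0 0).
by rewrite scaler0 addr0 mulN1r addNr.
Qed.

Lemma alternating_vec2 (E : lmodType R) (f : ('I_2 -> E) -> R) v :
  alternating f -> f (vec2 v v) = 0.
Proof. by move=> /(_ (vec2 v v) ord0 ord_max isT); apply. Qed.

(** Naming the base point [y] allows its replacement although the type of the vectors depends on
    it. *)
Lemma local_repE M k (w : rform M k) c (a : model M c) h y :
  phiV M c a = y ->
  local_rep w a h = w y (fun i => 'd (phi M (chart_at M y) \o phiV M c) a (h i)).
Proof. by move=> <-. Qed.

(** The local representative is jointly continuous and vanishes on zero vectors, so it is at most 1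
    on small vectors, and bilinearity gives a global bound. *)
Lemma form_bounded_bilinear M (w : rform M 2) (y : M) : is_form w ->
  bounded_bilinear (fun u v : tangent y => w y (vec2 u v)).
Proof.
move=> [/(_ y)[wm wa] ws]; apply: bounded_bilinear_near0.
- exact: multilinear_vec2l.
- exact: multilinear_vec2r.
pose F (z : jet (model M (chart_at M y)) 2) : R^o :=
  local_rep w (jet_base z) (jet_vec z).
have FE (u v : tangent y) : F (phi M (chart_at M y) y, u, v) = w y (vec2 u v).
  rewrite /F (local_repE w _ (phi_chart_atK y)); congr (w y).
  apply/funext => i; rewrite diff_chart_id /vec2 /=.
  case: unliftP => [j ->|->] //=.
  by rewrite (ord1 j); case: unliftP => [[]|] //.
have cont : {for (phi M (chart_at M y) y, 0, 0), continuous F}.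
  by apply: (ws _ 0%N); exists y => //; apply: chart_at_dom.
have F0 : F (phi M (chart_at M y) y, 0, 0) = 0 by rewrite FE multilinear_vec20l.
have := cont (ball (F (phi M (chart_at M y) y, 0, 0)) 1) => /(_ (nbhsx_ballx _ _ ltr01)).
move=> /nbhs_ballP[e e0 he]; exists e => // u v ue ve.
rewrite -FE; have /he : ball ((phi M (chart_at M y) y, 0, 0) : jet (model M (chart_at M y)) 2)
   e (phi M (chart_at M y) y, u, v).
  by split; [split; [exact: ballxx|]|]; rewrite -ball_normE /= sub0r normrN.
by rewrite /= F0 -ball_normE /= sub0r normrN => /ltW.
Qed.

End TwoForms.

(** * The IM-form as a shuffle sum *)

Section IMForm.
Context {R : realType} (X : smanifold R).
Implicit Types (a : bform X) (x : X 0%N).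

(* Only meaningful when [t] and [u] have the same degree. *)
Definition form_val a x (t u : tvec_psset x) : R :=
  a (projT1 t) 2 (dgn0 (projT1 t) x) (vec2 (projT2 t) (tagged_as t u)).
Arguments form_val a {x} t u.

Lemma form_valE a x l (v w : tgt x l) :
  form_val a (existT (tgt x) l v) (existT (tgt x) l w) = a l 2 (dgn0 l x) (vec2 v w).
Proof. by rewrite /form_val tagged_asE. Qed.

Lemma form_val_zerol a x t u : (forall l y, multilinear (a l 2 y)) ->
  zel t -> form_val (x := x) a t u = 0.
Proof.
case: t => l v am; rewrite /= /tvec_zero /= => v0.
by rewrite /form_val /= v0 multilinear_vec20l.
Qed.

Lemma form_val_zeror a x t u :
  (forall l y, multilinear (a l 2 y)) -> (forall l y, alternating (a l 2 y)) ->
  zel u -> form_val (x := x) a t u = 0.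
Proof.
case: u => l w am aa; rewrite /= /tvec_zero /= => w0.
case: t => k v; have [e|ne] := eqVneq k l.
  by subst k; rewrite form_valE w0 multilinear_vec20r.
(* In unequal degrees [tagged_as] returns the first vector, and the form vanishes on a repeated
   vector. *)
rewrite /form_val /tagged_as /= ; case: eqP => [e|_].
  by rewrite e eqxx in ne.
exact: alternating_vec2.
Qed.

Lemma imform_shuffle_sum m a x p q (v : tgt x p) (w : tgt x q) : (p + q)%N = m ->
  imform m a v w =
  shuffle_sum (form_val a) m p (existT (tgt x) p v) (existT (tgt x) q w).
Proof.
move=> <-; rewrite /imform eqxx; apply: eq_bigr => s hs.
have pn : (p <= p + q)%N by rewrite leq_addr.
have qE : (p + q - p)%N = q by rewrite addKn.
have hl := shuffle_rangel pn hs; rewrite qE in hl.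
have hr := shuffle_ranger pn hs; rewrite qE in hr.
rewrite /shuffle_term qE -(tmap_dgns _ hl) -(tmap_dgns_cast (addnC q p) _ hr).
by rewrite form_valE.
Qed.

Lemma imform0 m a x p q (v : tgt x p) (w : tgt x q) :
  (forall y u, a m 2 y u = 0) -> imform m a v w = 0.
Proof.
move=> a0; rewrite /imform; case: eqP => // e; subst m.
by apply: big1 => s _; rewrite a0 mulr0.
Qed.

Lemma imformD m a b x p q (v : tgt x p) (w : tgt x q) :
  imform m (bform_add a b) v w = imform m a v w + imform m b v w.
Proof.
rewrite /imform; case: eqP => _; last by rewrite addr0.
by rewrite -big_split; apply: eq_bigr => s _; rewrite /bform_add mulrDr.
Qed.

Lemma imform_bounded_bilinear m a x p q :
  bounded_bilinear (fun v w : tgt x m => a m 2 (dgn0 m x) (vec2 v w)) ->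
  bounded_bilinear (fun (v : tgt x p) (w : tgt x q) => imform m a v w).
Proof.
move=> ab; rewrite /imform; case: eqP => [e|_]; last exact: bounded_bilinear0.
subst m; apply: bounded_bilinear_sum => s hs; apply: bounded_bilinearZ.
have pn : (p <= p + q)%N by rewrite leq_addr.
have qE : (p + q - p)%N = q by rewrite addKn.
have hl := shuffle_rangel pn hs; rewrite qE in hl.
have hr := shuffle_ranger pn hs; rewrite qE in hr.
apply: (bounded_bilinear_comp ab).
- exact: tmap_linear.
- exact: tmap_linear.
- exact: tmap_dgns_cast_bounded hr.
- apply: tmap_bounded; [exact: dgns_dgn0|exact: dgns_tdiff].
Qed.

Lemma pullbackE (M N : manifold R) (f : M -> N) k (w : rform N k) (x : M) (y : N)
    (u : 'I_k -> tangent x) :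
  f x = y -> pullback f w u = w y (fun i => tmap f y (u i)).
Proof. by move=> <-. Qed.

Lemma map_vec2 (E F : Type) (f : E -> F) v w :
  (fun i => f (vec2 v w i)) = vec2 (f v) (f w).
Proof. by apply/funext => i; rewrite /vec2; case: ifP. Qed.

Lemma dform0 (M : manifold R) k (w : rform M k) y u :
  (forall z h, w z h = 0) -> dform w (x := y) u = 0.
Proof.
move=> w0; apply: big1 => i _.
rewrite (_ : (fun _ => _) = cst (0 : R^o)).
  by rewrite diff_cst mulr0.
by apply/funext => z; rewrite /local_rep w0.
Qed.

(** Since the 1-form at level m + 1 is zero, only the simplicial part of D contributes. *)
Lemma totalD_vec2 a m x (v w : tgt x m.+1) : (forall y u, a m.+1 1 y u = 0) ->
  @totalD R X a m.+1 2 (dgn0 m.+1 x) (vec2 v w) =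
  \sum_(i < m.+2) (-1) ^+ i * a m 2 (dgn0 m x) (vec2 (tgt_face i v) (tgt_face i w)).
Proof.
move=> a0.
transitivity (@simpl_delta R X m 2 (a m 2) (dgn0 m.+1 x) (vec2 v w) +
  (-1) ^+ m.+1 * @dform R (X m.+1) 1 (a m.+1 1) (dgn0 m.+1 x) (vec2 v w)).
  by [].
rewrite dform0 // mulr0 addr0; apply: eq_bigr => i _.
rewrite (pullbackE _ _ (face_dgn0 x _)); last by rewrite -ltnS.
by rewrite map_vec2.
Qed.

Lemma totalD_bounded_bilinear a m x : (forall y u, a m.+1 1 y u = 0) ->
  bounded_bilinear (fun v w : tgt x m => a m 2 (dgn0 m x) (vec2 v w)) ->
  bounded_bilinear (fun v w : tgt x m.+1 =>
    @totalD R X a m.+1 2 (dgn0 m.+1 x) (vec2 v w)).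
Proof.
move=> a0 ab.
have -> : (fun v w : tgt x m.+1 =>
    @totalD R X a m.+1 2 (dgn0 m.+1 x) (vec2 v w)) =
  (fun v w => \sum_(i < m.+2) (-1) ^+ i *
    a m 2 (dgn0 m x) (vec2 (tgt_face i v) (tgt_face i w))).
  by apply/funext => v; apply/funext => w; exact: totalD_vec2.
apply: bounded_bilinear_sum => i _; apply: bounded_bilinearZ.
have il : (i <= m.+1)%N by rewrite -ltnS.
by apply: (bounded_bilinear_comp ab);
  [exact: tgt_face_linear|exact: tgt_face_linear|..];
  apply: tmap_bounded; [exact: face_dgn0|exact: face_tdiff
    |exact: face_dgn0|exact: face_tdiff].
Qed.

Lemma form_val_totalD a m x (t u : tvec_psset x) : (forall y h, a m.+1 1 y h = 0) ->
  deg t = m.+1 -> deg u = m.+1 ->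
  form_val (totalD a) t u =
  \sum_(i < m.+2) (-1) ^+ i * form_val a (dop i t) (dop i u).
Proof.
case: t => l v; case: u => k w a0; rewrite /= /tvec_deg /= => el ek; subst l k.
rewrite form_valE totalD_vec2 //; apply: eq_bigr => i _.
by rewrite -form_valE.
Qed.

Lemma imform_totalD a m x p q (v : tgt x p) (w : tgt x q) :
  (forall y h, a m.+1 1 y h = 0) -> (p + q)%N = m.+1 ->
  imform m.+1 (totalD a) v w =
  \sum_(i < m.+2) (-1) ^+ i *
    shuffle_sum (fun t u => form_val a (dop i t) (dop i u)) m.+1 p
      (existT (tgt x) p v : tvec_psset x) (existT (tgt x) q w).
Proof.
move=> a0 pq; rewrite imform_shuffle_sum //.
under eq_bigr do rewrite /shuffle_sum big_distrr /=.
rewrite exchange_big /=; apply: eq_bigr => s hs.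
rewrite /shuffle_term (form_val_totalD (m := m)) //; last 2 first.
- by rewrite deg_sops /= /tvec_deg /=; lia.
- by rewrite deg_sops /= /tvec_deg /=; lia.
by rewrite big_distrr /=; apply: eq_bigr => i _; rewrite mulrCA.
Qed.

Lemma in_tc_zel x l (v : tgt x l) : in_tc v ->
  forall i, (i < l)%N -> zel (dop i (existT (tgt x) l v : tvec_psset x)).
Proof. by case: l v => [//|l] v h i il; exact: h. Qed.

Lemma imform_boundary a m x p q (v : tgt x p) (w : tgt x q) :
  (forall l y, multilinear (a l 2 y)) -> (forall l y, alternating (a l 2 y)) ->
  (forall y h, a m.+1 1 y h = 0) ->
  (p + q)%N = m.+1 -> in_tc v -> in_tc w ->
  imform m.+1 (totalD a) v w =
  (if p is p'.+1 then (-1) ^+ p * shuffle_sum (form_val a) m p'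
     (dop p (existT (tgt x) p v : tvec_psset x)) (existT (tgt x) q w) else 0) +
  (if q is q'.+1 then (-1) ^+ m.+1 * shuffle_sum (form_val a) m p
     (existT (tgt x) p v : tvec_psset x) (dop q (existT (tgt x) q w : tvec_psset x)) else 0).
Proof.
move=> am aa a0 pq hv hw; rewrite imform_totalD //.
apply: (shuffle_sum_boundary pq) => //.
- exact: in_tc_zel.
- exact: in_tc_zel.
- by move=> t u; apply: form_val_zerol.
- by move=> t u; apply: form_val_zeror.
Qed.

End IMForm.

Arguments form_val {R X} a {x} t u.

(** * Shifted 2-forms *)

Section ShiftedForms.
Context {R : realType} (X : smanifold R).
Implicit Types (a : bform X) (x : X 0%N).

Lemma shifted_multilinear (s : int) a : shifted_2form s a ->
  forall l y, multilinear (a l 2 y).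
Proof. by move=> [af _ _] l y; have [/(_ y)[]] := af l 2. Qed.

Lemma shifted_alternating (s : int) a : shifted_2form s a ->
  forall l y, alternating (a l 2 y).
Proof. by move=> [af _ _] l y; have [/(_ y)[]] := af l 2. Qed.

Lemma shifted_above m a : shifted_2form m%:Z a -> forall y h, a m.+1 1 y h = 0.
Proof. by move=> [_ _ az]; apply: az; lia. Qed.

Lemma shifted_bounded_bilinear (s : int) m a x : shifted_2form s a ->
  bounded_bilinear (fun v w : tgt x m => a m 2 (dgn0 m x) (vec2 v w)).
Proof. by move=> [af _ _]; apply: form_bounded_bilinear. Qed.

Lemma shifted_dgn (s : int) a x j (t u : tvec_psset x) : shifted_2form s a ->
  (j <= deg t)%N -> deg t = deg u -> form_val a (sop j t) (sop j u) = 0.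
Proof.
case: t => l v; case: u => k w [_ an _]; rewrite /= /tvec_deg /= => jl e.
subst k; rewrite form_valE; have := an l 2 j (dgn0 l x) (vec2 v w) jl.
by rewrite (pullbackE _ _ (dgn_dgn0 x jl)) map_vec2.
Qed.

Lemma imform_dgn m a x p q i (u : tgt x p) (w : tgt x q) :
  shifted_2form m%:Z a -> (p.+1 + q = m)%N -> (i <= p)%N ->
  imform m a (tgt_dgn i u) w = 0.
Proof.
move=> sa pq ip; rewrite imform_shuffle_sum //.
apply: (shuffle_sum_sop (v := existT (tgt x) p u : tvec_psset x)) => //.
- by lia.
- by rewrite /= /tvec_deg /=; lia.
by move=> j t t' jt dt dt'; apply: shifted_dgn sa jt _; rewrite dt.
Qed.

Lemma imform_bdl m a x p q (v : tgt x p.+1) (w : tgt x q) :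
  shifted_2form m%:Z a -> (p + q)%N = m ->
  imform m a (bd v) w = (-1) ^+ p.+1 * shuffle_sum (form_val a) m p
    (dop p.+1 (existT (tgt x) p.+1 v : tvec_psset x)) (existT (tgt x) q w).
Proof.
move=> sa pq.
have [bl br _] := imform_bounded_bilinear p q (shifted_bounded_bilinear m x sa).
have := bilinear_scale ((-1) ^+ p.+1) 1 (tgt_face p.+1 v) w bl br.
by rewrite scale1r mulr1 -imform_shuffle_sum.
Qed.

Lemma imform_bdr m a x p q (v : tgt x p) (w : tgt x q.+1) :
  shifted_2form m%:Z a -> (p + q)%N = m ->
  imform m a v (bd w) = (-1) ^+ q.+1 * shuffle_sum (form_val a) m p
    (existT (tgt x) p v : tvec_psset x) (dop q.+1 (existT (tgt x) q.+1 w : tvec_psset x)).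
Proof.
move=> sa pq.
have [bl br _] := imform_bounded_bilinear p q (shifted_bounded_bilinear m x sa).
have := bilinear_scale 1 ((-1) ^+ q.+1) v (tgt_face q.+1 w) bl br.
by rewrite scale1r mul1r -imform_shuffle_sum.
Qed.

Lemma imform_totalD_bd m a x p q (v : tgt x p.+1) (w : tgt x q.+1) :
  shifted_2form m%:Z a -> (p + q.+1)%N = m -> in_tc v -> in_tc w ->
  imform m.+1 (totalD a) v w =
  imform m a (bd v) w + (-1) ^+ p.+1 * imform m a v (bd w).
Proof.
move=> sa pq hv hw; rewrite (imform_boundary (shifted_multilinear sa)
  (shifted_alternating sa) (shifted_above sa)) //; last lia.
rewrite imform_bdl // imform_bdr //; last lia.
(* The sign of [bd w] turns (-1)^(p+1) into (-1)^(p+q+2) = (-1)^(m+1). *)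
congr (_ + _); rewrite mulrA -exprD; congr (_ ^+ _ * _); lia.
Qed.

Lemma imform_totalD_bdl m a x (v : tgt x m.+1) (w : tgt x 0) :
  shifted_2form m%:Z a -> in_tc v -> in_tc w ->
  imform m.+1 (totalD a) v w = imform m a (bd v) w.
Proof.
move=> sa hv hw; rewrite (imform_boundary (shifted_multilinear sa)
  (shifted_alternating sa) (shifted_above sa)) ?addn0 //.
by rewrite addr0 imform_bdl ?addn0.
Qed.

Lemma imform_totalD_bdr m a x (v : tgt x 0) (w : tgt x m.+1) :
  shifted_2form m%:Z a -> in_tc v -> in_tc w ->
  imform m.+1 (totalD a) v w = imform m a v (bd w).
Proof.
move=> sa hv hw; rewrite (imform_boundary (shifted_multilinear sa)
  (shifted_alternating sa) (shifted_above sa)) //.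
by rewrite add0r imform_bdr.
Qed.

(* [imform_sharp] with the degree of the second argument as a free index k, so
   that one can argue by cases on the sign of k. *)
Definition imform_int m a x (i k : int) : tc x i -> tc x k -> R :=
  match i, k return tc x i -> tc x k -> R with
  | Posz p, Posz q => @imform R X m a x p q
  | _, _ => fun _ _ => 0
  end.
Arguments imform_int : clear implicits.

Lemma imform_sharpE m a x i j (v : tc x i) (w : tc x (- (j - m%:Z))) :
  imform_sharp m a x i j v w = imform_int m a x i (- (j - m%:Z)) v w.
Proof. by []. Qed.

Lemma imform_int_bounded_bilinear m a x i k :
  bounded_bilinear (fun v w : tgt x m => a m 2 (dgn0 m x) (vec2 v w)) ->
  bounded_bilinear (imform_int m a x i k).
Proof.
move=> ab; case: i k => [p|p] [q|q]; last 3 first.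
- exact: bounded_bilinear0.
- exact: bounded_bilinear0.
- exact: bounded_bilinear0.
exact: imform_bounded_bilinear.
Qed.

(** The transport in [tc_d] is along a proof of [p.+1 = p.+1], trivial by uniqueness of identity
    proofs on nat. *)
Lemma tc_dE x p (v : tc x p.+1%:Z) : @tc_d R X x p.+1%:Z p%:Z v = bd v.
Proof. by rewrite /tc_d; case: eqP => // e; rewrite (eq_axiomK e). Qed.

(** The boundary formula in the form of the homotopy equation. The target degrees [i'] and [k'] are
    variables so that they can be substituted once the signs of the degrees are known. *)
Lemma imform_int_totalD m a x i k i' k' (v : tc x i) (w : tc x k) :
  shifted_2form m%:Z a -> i + k = m.+1%:Z -> i' = i - 1 -> k' = k - 1 ->
  tc_in v -> tc_in w ->
  imform_int m.+1 (totalD a) x i k v w =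
  (-1) ^ m.+1%:Z * ((-1) ^ (k' + 1) * imform_int m a x i k' v (@tc_d R X x k k' w)) +
  imform_int m a x i' k (@tc_d R X x i i' v) w.
Proof.
move=> sa; case: i v => p v; last first.
  move=> _ ei _ _ _; have [p' ->] : exists p', i' = Negz p'.
    by exists p.+1; rewrite ei; lia.
  by rewrite /= !mulr0 addr0.
case: k w => q w; last first.
  move=> _ _ ek _ _; have [q' ->] : exists q', k' = Negz q'.
    by exists q.+1; rewrite ek; lia.
  by case: i' => i' /=; rewrite !mulr0 addr0.
case: p v => [|p] v; case: q w => [|q] w pq ei ek.
- by lia.
- have {ei} -> : i' = Negz 0 by lia.
  have {ek} -> : k' = q%:Z by lia.
  have ? : q = m by lia.
  subst q; rewrite tc_dE => hv hw; rewrite /= addr0.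
  rewrite imform_totalD_bdr // mulrA -[_ ^ (_ + _)]/((-1) ^ (m + 1)%:Z) -!exprnP.
  by rewrite addn1 -expr2 sqrr_sign mul1r.
- have {ei} -> : i' = p%:Z by lia.
  have {ek} -> : k' = Negz 0 by lia.
  have ? : p = m by lia.
  subst p; rewrite tc_dE => hv hw; rewrite /= !mulr0 add0r.
  exact: imform_totalD_bdl.
have {ei} -> : i' = p%:Z by lia.
have {ek} -> : k' = q%:Z by lia.
rewrite !tc_dE => hv hw; rewrite /= imform_totalD_bd //; last lia.
(* As m = p + q + 1, the exponents m + 1 + (q + 1) and p + 1 have the same parity. *)
rewrite addrC mulrA -[_ ^ (_ + _)]/((-1) ^ (q + 1)%:Z) -!exprnP -exprD.
congr (_ * _ + _); rewrite -signr_odd -[in RHS]signr_odd; congr (_ ^+ _); congr (nat_of_bool _).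
lia.
Qed.

End ShiftedForms.
Arguments imform_int {R X} m a x i k v w.

(** * Gauge invariance up to homotopy, and the theorem *)

Lemma chain_homotopic_totalD (R : realType) (X : smanifold R) (m : nat)
    (alpha phi : bform X) (x : X 0%N) :
  shifted_2form m%:Z alpha -> shifted_2form (m%:Z - 1) phi ->
  chain_homotopic (imform_sharp m (bform_add alpha (totalD phi)) x)
    (imform_sharp m alpha x).
Proof.
move=> sa sp.
(* The level [n] and degree [r] are free: the two maps compared have level m and degree 0, the
   homotopy has level m - 1 and degree 1. *)
have graded_int n (a : bform X) r : bounded_bilinear (fun v w : tgt x n =>
    a n 2 (dgn0 n x) (vec2 v w)) ->
    graded_map r ((fun i j v w => imform_int n a x i (- (j - m%:Z)) v w) : gmap x m).
  move=> ab i; have [bl br bC] := imform_int_bounded_bilinear i (- (i + r - m%:Z)) ab.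
  split=> [c v v' w _ _ _|c v w w' _ _ _|]; [exact: bl|exact: br|].
  by have [C h] := bC; exists C => v w _ _; exact: h.
have ba := shifted_bounded_bilinear m x sa.
have diffE i j (v : tc x i) (w : tc x (- (j - m%:Z))) :
    imform_sharp m (bform_add alpha (totalD phi)) x i j v w -
    imform_sharp m alpha x i j v w =
    imform_int m (totalD phi) x i (- (j - m%:Z)) v w.
  rewrite !imform_sharpE; case: i v => p v; last by rewrite subr0.
  by case: (- _) w => q w /=; rewrite ?subr0 // imformD addrC addKr.
(* By additivity the difference is the IM-form of [totalD phi], so [alpha] drops out. *)
suff [bD [h [gh eh]]] : bounded_bilinear (fun v w : tgt x m =>
      @totalD R X phi m 2 (dgn0 m x) (vec2 v w)) /\
    exists h : gmap x m, graded_map 1 h /\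
    forall i (v : tc x i) (w : tc x (- (i - m%:Z))), tc_in v -> tc_in w ->
      imform_int m (totalD phi) x i (- (i - m%:Z)) v w =
      @sct_d R X x m (i + 1) i (h i (i + 1) v) w +
      h (i - 1) i (@tc_d R X x i (i - 1) v) w.
  split; [|exact: graded_int|].
    by apply: graded_int; apply: bounded_bilinearD.
  by exists h; split=> // i v w hv hw; rewrite diffE eh.
case: m sa sp ba graded_int diffE => [|m] sa sp ba graded_int diffE.
  (* For m = 0 the form [phi] is (-1)-shifted, hence zero, and the zero homotopy works. *)
  have phi0 i k y u : phi i k y u = 0.
    by have [_ _ h] := sp; apply: h; lia.
  have D0 y u : @totalD R X phi 0 2 y u = 0.
    have e : @totalD R X phi 0 2 y u = 0 + (-1) ^+ 0 * @dform R (X 0%N) 1 (phi 0%N 1%N) y u.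
      by [].
    by rewrite e add0r dform0 ?mulr0.
  split.
    rewrite (_ : (fun v w => _) = (fun _ _ => 0)); first exact: bounded_bilinear0.
    by apply/funext => v; apply/funext => w; rewrite D0.
  exists (fun _ _ _ _ => 0); split.
    move=> i; split=> [*|*|]; rewrite ?mulr0 ?addr0 //.
    by exists 0 => v w _ _; rewrite normr0 !mul0r.
  have int0 i k (v : tc x i) (w : tc x k) : imform_int 0 (totalD phi) x i k v w = 0.
    by case: i v => p v //; case: k w => q w //; apply: imform0.
  by move=> i v w _ _; rewrite int0 /sct_d /ct_d mulr0 mulr0 addr0.
have spm : shifted_2form m%:Z phi.
  by move: sp; rewrite (_ : m.+1%:Z - 1 = m%:Z) //; lia.
have bp := shifted_bounded_bilinear m x spm.
split; first exact: totalD_bounded_bilinear (shifted_above spm) bp.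
(* The homotopy is the IM-form of [phi], one level below that of [alpha]. *)
exists (fun i j v w => imform_int m phi x i (- (j - m.+1%:Z)) v w); split.
  exact: graded_int.
by move=> i v w hv hw; apply: imform_int_totalD => //; lia.
Qed.

Theorem lemmaE1 (R : realType) (n : nat) (X : smanifold R)
    (HX : lie_groupoid X n) (m : nat) (alpha : bform X)
    (Halpha : shifted_2form m%:Z alpha) :
  (* (1) *)
  (forall (x : X 0%N) (p q i : nat) (u : tgt x p) (w : tgt x q),
     (p.+1 + q = m)%N -> (i <= p)%N ->
     imform m alpha (tgt_dgn i u) w = 0) /\
  (* (2) *)
  [/\ forall (x : X 0%N) (p q : nat) (v : tgt x p.+1) (w : tgt x q.+1),
        (p + q.+1 = m)%N -> in_tc v -> in_tc w ->
        imform m alpha (bd v) w + (-1) ^+ p.+1 * imform m alpha v (bd w) =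
        imform m.+1 (totalD alpha) v w,
      forall (x : X 0%N) (v : tgt x 1) (w : tgt x 0),
        m = 0%N -> in_tc v -> in_tc w ->
        imform m alpha (bd v) w = imform m.+1 (totalD alpha) v w
    & bform_zero (totalD alpha) ->
      forall (x : X 0%N) (p q : nat) (v : tgt x p.+1) (w : tgt x q),
        (p + q = m)%N -> in_tc v -> in_tc w ->
        imform m.+1 (totalD alpha) v w = 0] /\
  (* (3) *)
  (forall phi : bform X, shifted_2form (m%:Z - 1) phi ->
   forall x : X 0%N,
     chain_homotopic
       (imform_sharp m (bform_add alpha (totalD phi)) x)
       (imform_sharp m alpha x)).
Proof.
split; [|split; [split|]].
- by move=> x p q i u w; apply: imform_dgn.
- by move=> x p q v w pq hv hw; rewrite imform_totalD_bd.
- by move=> x v w m0 hv hw; subst m; rewrite imform_totalD_bdl.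
- by move=> D0 x p q v w _ _ _; apply: imform0 => y u; apply: D0.
- by move=> phi hphi x; apply: chain_homotopic_totalD.
Qed.
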